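(* Let $\mathcal{H}$ be a hereditarily closed family of finite bipartite graphs. The following are equivalent: (1) any ultraproduct of the graphs in $\mathcal{H}$ satisfies perfect stable regularity; (2) the family $\mathcal{H}$ satisfies approximately perfect stable regularity; (3) the family $\mathcal{H}$ satisfies strong stable regularity; (4) the family $\mathcal{H}$ satisfies stable regularity; (5) there is some $d\in\mathbb{N}$ so that all graphs in $\mathcal{H}$ are $d$-stable.
   Context: A finite bipartite graph is $H=(E;X_1,X_2)$ with $X_1,X_2$ finite nonempty sets and $E\subseteq X_1\times X_2$. A family $\mathcal{H}$ is hereditarily closed if whenever $(E;X_1,X_2)\in\mathcal{H}$ and $\emptyset\ne X_i'\subseteq X_i$, also $(E\cap(X_1'\times X_2');X_1',X_2')\in\mathcal{H}$. $H$ is $d$-stable if there are no $a_1,\dots,a_d\in X_1$, $b_1,\dots,b_d\in X_2$ with $(a_i,b_j)\in E\iff i\le j$ for all $1\le i,j\le d$. $\mathcal{H}$ satisfies: - approximately perfect stable regularity if for every $\varepsilon>0$ and every $f:\mathbb{N}\to(0,1)$ there is $N=N(f,\varepsilon)$ so that for any $H\in\mathcal{H}$ there exist $N'\le N$ and partitions $X_i=\bigsqcup_{0\le t<N'}A_{i,t}$ ($i=1,2$) with (a) $|A_{i,0}|\le\varepsilon|X_i|$; (b) for $i\in\{1,2\}$ and $1\le t<N'$, $\frac{|A_{i,t}\cap E_b|}{|A_{i,t}|}\in[0,f(N'))\cup(1-f(N'),1]$ for all but at most an $f(N')$ fraction of the elements $b\in X_{3-i}$, where $E_b\subseteq X_i$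 is the fiber of $E$ at $b$; - strong stable regularity if for every $\varepsilon>0$ and every $f:\mathbb{N}\to(0,1]$ there is $N=N(f,\varepsilon)$ so that for any $H\in\mathcal{H}$ there exist $N'\le N$ and partitions $X_i=\bigsqcup_{0\le t<N'}A_{i,t}$ with (a) $|A_{i,0}|\le\varepsilon|A_{i,1}|$ for $i=1,2$; (b) for any $1\le t_1,t_2<N'$, $\frac{|E\cap(A_{1,t_1}\times A_{2,t_2})|}{|A_{1,t_1}\times A_{2,t_2}|}\in[0,f(N'))\cup(1-f(N'),1]$; - stable regularity if for every $\varepsilon>0$ there is $N=N(\varepsilon)$ so that for any $H\in\mathcal{H}$ there exist $N'\le N$ and partitions $X_i=\bigsqcup_{1\le t<N'}A_{i,t}$ so that for any $1\le t_1,t_2<N'$, $\frac{|E\cap(A_{1,t_1}\times A_{2,t_2})|}{|A_{1,t_1}\times A_{2,t_2}|}\in[0,\varepsilon)\cup(1-\varepsilon,1]$. Ultraproducts: given $H_n=(E_n;X_{1,n},X_{2,n})\in\mathcal{H}$, $n\in\mathbb{N}$, and an ultrafilter $\mathcal{U}$ on $\mathbb{N}$, let $\widetilde X_i=\prod_nX_{i,n}/\mathcal{U}$, $\widetilde E=\prod_nE_n/\mathcal{U}$. For $S$ any finite product of the $X_i$'s, internal subsets of $\widetilde S$ are those of the form $\prod_nA_n/\mathcal{U}$ with $A_n\subseteq S_n$; $\mathcal{B}_{\widetilde S}$ is the $\sigma$-algebra they generate and $\mu_{\widetilde S}$ the unique countably additive probability measure on it with $\mu_{\widetilde S}(\prod_nA_n/\mathcal{U})=\lim_{n\to\mathcal{U}}|A_n|/|S_n|$.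 The ultraproduct satisfies perfect stable regularity if there are countable partitions $\widetilde X_i=\bigsqcup_{t\in\mathbb{N}}A_{i,t}$, $A_{i,t}\in\mathcal{B}_{\widetilde X_i}$ ($i=1,2$), so that for all $t_1,t_2\in\mathbb{N}$ the density $\mu(\widetilde E\cap(A_{1,t_1}\times A_{2,t_2}))/\mu(A_{1,t_1}\times A_{2,t_2})$ is $0$ or $1$, where $\mu=\mu_{\widetilde X_1\times\widetilde X_2}$. Convention: parts of partitions may be empty; conditions on a ratio are only required when the denominator is nonzero. *)

(* Defs.v *)
From HB Require Import structures.
From mathcomp Require Import all_boot all_order all_algebra generic_quotient.
From mathcomp Require Import all_classical all_reals all_analysis.
Import Order.TTheory GRing.Theory Num.Theory.
Import numFieldNormedType.Exports.

Set Implicit Arguments.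
Unset Strict Implicit.
Unset Printing Implicit Defensive.

Local Open Scope classical_set_scope.
Local Open Scope ring_scope.

Record nefinType := NEFin {
  nef_sort :> finType;
  nef_gt0 : (0 < #|nef_sort|)%N
}.

Lemma nef_prod_subproof (X Y : nefinType) : (0 < #|{: X * Y}|)%N.
Proof. by rewrite card_prod muln_gt0 !nef_gt0. Qed.

Definition nef_prod (X Y : nefinType) : nefinType :=
  NEFin (nef_prod_subproof X Y).

Definition nef_fst (X Y : nefinType) (p : nef_prod X Y) : X := p.1.
Definition nef_snd (X Y : nefinType) (p : nef_prod X Y) : Y := p.2.

Lemma nef_sub_subproof (X : finType) (A : {set X}) :
  A != finset.set0 -> (0 < #|{: {x : X | x \in A}}|)%N.
Proof. by rewrite card_sig -card_gt0. Qed.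

Definition nef_sub (X : finType) (A : {set X}) (A0 : A != finset.set0) :
  nefinType := NEFin (nef_sub_subproof A0).

Record bigraph := BiGraph {
  lpart : nefinType;
  rpart : nefinType;
  edges : {set lpart * rpart}
}.

Definition induced (G : bigraph) (A : {set lpart G}) (B : {set rpart G})
    (A0 : A != finset.set0) (B0 : B != finset.set0) : bigraph :=
  @BiGraph (nef_sub A0) (nef_sub B0)
    [set p | (val p.1, val p.2) \in edges G]%SET.

Definition hereditarily_closed (F : bigraph -> Prop) : Prop :=
  forall (G : bigraph) (A : {set lpart G}) (B : {set rpart G})
    (A0 : A != finset.set0) (B0 : B != finset.set0),
    F G -> F (induced A0 B0).

Definition stable (d : nat) (G : bigraph) : Prop :=
  ~ exists (a : 'I_d -> lpart G) (b : 'I_d -> rpart G),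
      forall i j : 'I_d, (a i, b j) \in edges G <-> (i <= j)%N.

(* Parts may be empty, unlike in classical_sets.partition. *)
Definition is_partition (T : Type) (D : set nat) (A : nat -> set T) : Prop :=
  trivIset D A /\ \bigcup_(t in D) A t = [set: T].

Definition is_fpartition (T : finType) (D : set nat) (A : nat -> {set T}) :
  Prop := is_partition D (fun t => [set` A t]).

Section Regularity.
Variable R : realType.

Definition near01 (e r : R) : bool :=
  (r \in `[0, e[) || (r \in `]1 - e, 1]).

Definition pair_density (X Y : finType) (E : {set X * Y})
    (A : {set X}) (B : {set Y}) : R :=
  #|E :&: finset.setX A B|%SET%:R / #|finset.setX A B|%:R.

Definition homogeneous_pair (X Y : finType) (E : {set X * Y}) (e : R)
    (A : {set X}) (B : {set Y}) : Prop :=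
  finset.setX A B != finset.set0 -> near01 e (pair_density E A B).

(* [E b] is the fiber at b. *)
Definition fiber_density (X Y : finType) (E : Y -> {set X}) (A : {set X})
    (b : Y) : R :=
  #|A :&: E b|%SET%:R / #|A|%:R.

Definition mostly_homogeneous (X Y : finType) (E : Y -> {set X}) (e : R)
    (A : {set X}) : Prop :=
  A != finset.set0 ->
  #|[set b | ~~ near01 e (fiber_density E A b)]%SET|%:R <= e * #|Y|%:R.

Definition lfiber (G : bigraph) (b : rpart G) : {set lpart G} :=
  [set a | (a, b) \in edges G]%SET.

Definition rfiber (G : bigraph) (a : lpart G) : {set rpart G} :=
  [set b | (a, b) \in edges G]%SET.

Definition approximately_perfect_stable_regularity (F : bigraph -> Prop) : Prop :=
  forall (eps : R) (f : nat -> R), 0 < eps -> (forall n, 0 < f n < 1) ->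
  exists N : nat, forall G : bigraph, F G ->
  exists N' : nat, (N' <= N)%N /\
  exists (A1 : nat -> {set lpart G}) (A2 : nat -> {set rpart G}),
  [/\ is_fpartition [set t | (t < N')%N] A1
      /\ is_fpartition [set t | (t < N')%N] A2,
      #|A1 0%N|%:R <= eps * #|lpart G|%:R
      /\ #|A2 0%N|%:R <= eps * #|rpart G|%:R
    & forall t, (1 <= t < N')%N ->
      mostly_homogeneous (@lfiber G) (f N') (A1 t)
      /\ mostly_homogeneous (@rfiber G) (f N') (A2 t)].

(* [1 < N'] expresses that the part of index 1 exists. *)
Definition strong_stable_regularity (F : bigraph -> Prop) : Prop :=
  forall (eps : R) (f : nat -> R), 0 < eps -> (forall n, 0 < f n <= 1) ->
  exists N : nat, forall G : bigraph, F G ->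
  exists N' : nat, (1 < N' <= N)%N /\
  exists (A1 : nat -> {set lpart G}) (A2 : nat -> {set rpart G}),
  [/\ is_fpartition [set t | (t < N')%N] A1
      /\ is_fpartition [set t | (t < N')%N] A2,
      #|A1 0%N|%:R <= eps * #|A1 1%N|%:R
      /\ #|A2 0%N|%:R <= eps * #|A2 1%N|%:R
    & forall t1 t2, (1 <= t1 < N')%N -> (1 <= t2 < N')%N ->
      homogeneous_pair (edges G) (f N') (A1 t1) (A2 t2)].

Definition stable_regularity (F : bigraph -> Prop) : Prop :=
  forall eps : R, 0 < eps ->
  exists N : nat, forall G : bigraph, F G ->
  exists N' : nat, (N' <= N)%N /\
  exists (A1 : nat -> {set lpart G}) (A2 : nat -> {set rpart G}),
  [/\ is_fpartition [set t | (1 <= t < N')%N] A1,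
      is_fpartition [set t | (1 <= t < N')%N] A2
    & forall t1 t2, (1 <= t1 < N')%N -> (1 <= t2 < N')%N ->
      homogeneous_pair (edges G) eps (A1 t1) (A2 t2)].

End Regularity.

Section Ultraproduct.
Local Open Scope quotient_scope.
Variables (U : set_system nat) (UU : UltraFilter U).

Section Family.
Variable T : nat -> nefinType.

Definition ultra_eq (x y : forall n, T n) : bool :=
  `[< \forall n \near U, x n = y n >].

Lemma ultra_eq_equiv : equiv_class_of ultra_eq.
Proof.
split=> [x|x y|y x z].
- by apply/asboolP; near=> n.
- by apply/asbool_equiv_eq; split; apply: filterS => n ->.
- move=> /asboolP xy /asboolP yz; apply/asboolP.
  by near=> n; rewrite (near xy n)// (near yz n).
Unshelve. all: by end_near. Qed.

Canonical ultra_eq_equiv_rel := EquivRelPack ultra_eq_equiv.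

Definition ultraproduct : Type := {eq_quot ultra_eq}.
HB.instance Definition _ := EqQuotient.on ultraproduct.
HB.instance Definition _ := Choice.on ultraproduct.

Definition ultra_class (x : forall n, T n) : ultraproduct := \pi x.

HB.instance Definition _ := isPointed.Build ultraproduct
  (ultra_class (fun n => enum_val (Ordinal (nef_gt0 (T n))))).

Lemma ultra_classP (x y : forall n, T n) :
  ultra_class x = ultra_class y <-> \forall n \near U, x n = y n.
Proof.
by split=> [/eqP|xy]; [rewrite eqmodE => /asboolP
                      |apply/eqP; rewrite eqmodE; apply/asboolP].
Qed.

Definition internal_set (A : forall n, {set T n}) : set ultraproduct :=
  [set ultra_class x | x in [set x | \forall n \near U, x n \in A n]].

Definition internal_sets : set (set ultraproduct) := range internal_set.

(* Exactly one probability measure satisfies this: the internal sets form an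
   algebra, on which the limit densities are countably additive (Loeb). Hence
   it does not matter whether [perfect_stable_regularity] quantifies it
   existentially or universally. *)
Definition is_ultraproduct_measure (R : realType)
    (mu : probability (g_sigma_algebraType internal_sets) R) : Prop :=
  forall A : forall n, {set T n},
    ((#|A n|%:R / #|T n|%:R : R)%:E @[n --> U] --> mu (internal_set A)).

End Family.

Definition ultra_map (S T : nat -> nefinType) (f : forall n, S n -> T n)
    (z : ultraproduct S) : ultraproduct T :=
  ultra_class (fun n => f n (repr z n)).

Lemma ultra_mapE (S T : nat -> nefinType) (f : forall n, S n -> T n) x :
  ultra_map f (ultra_class x) = ultra_class (fun n => f n (x n)).
Proof.
apply/ultra_classP; have /ultra_classP : ultra_class (repr (ultra_class x)) =
  ultra_class x by rewrite /ultra_class reprK.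
by apply: filterS => n ->.
Qed.

Section Product.
Variables X Y : nat -> nefinType.

(* The ultraproduct of the X n * Y n is in bijection with the product of the
   ultraproducts of the X n and of the Y n, through the two projections;
   [ultra_rect A B] is A x B under this identification. *)
Definition ultra_rect (A : set (ultraproduct X)) (B : set (ultraproduct Y)) :
    set (ultraproduct (fun n => nef_prod (X n) (Y n))) :=
  [set z | A (ultra_map (fun n => @nef_fst (X n) (Y n)) z) /\
           B (ultra_map (fun n => @nef_snd (X n) (Y n)) z)].

Lemma ultra_rect_class A B x y :
  ultra_rect A B (@ultra_class (fun n => nef_prod (X n) (Y n))
                    (fun n => (x n, y n))) <->
  A (ultra_class x) /\ B (ultra_class y).
Proof. by rewrite /ultra_rect /= !ultra_mapE. Qed.

End Product.

Definition perfect_stable_regularity (R : realType) (G : nat -> bigraph) :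
    Prop :=
  let X := fun n => lpart (G n) in
  let Y := fun n => rpart (G n) in
  let E := internal_set (T := fun n => nef_prod (X n) (Y n))
             (fun n => edges (G n)) in
  exists mu : probability (g_sigma_algebraType
      (internal_sets (T := fun n => nef_prod (X n) (Y n)))) R,
  is_ultraproduct_measure mu /\
  exists (A1 : nat -> set (ultraproduct X)) (A2 : nat -> set (ultraproduct Y)),
  [/\ is_partition [set: nat] A1 /\ is_partition [set: nat] A2,
      forall t, (internal_sets (T := X)).-sigma.-measurable (A1 t),
      forall t, (internal_sets (T := Y)).-sigma.-measurable (A2 t)
    & forall t1 t2, mu (ultra_rect (A1 t1) (A2 t2)) != 0%E ->
      let density := fine (mu (E `&` ultra_rect (A1 t1) (A2 t2))) /
                     fine (mu (ultra_rect (A1 t1) (A2 t2))) in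
      density = 0 \/ density = 1].

End Ultraproduct.

(* Main.v *)
From HB Require Import structures.
Require Import Defs.
From mathcomp Require Import all_boot all_order all_algebra.
From mathcomp Require Import all_classical all_reals all_analysis.
From mathcomp Require Import zify ring lra.
Import Order.TTheory GRing.Theory Num.Theory.
Import numFieldNormedType.Exports.
Set Implicit Arguments.
Unset Strict Implicit.
Unset Printing Implicit Defensive.
Local Open Scope classical_set_scope.
Local Open Scope ring_scope.

(* Condition (5) gives all the others through ultraproducts.  Call an internal
   set A pure if every fibre meets it in a null set or in almost all of it.  An
   internal set of positive measure contains a pure one of positive measure:
   otherwise splitting it again and again by fibres yields a full binary tree,
   and a high tree contains a long half graph.  Exhausting the space greedily
   by pure sets leaves a null set.  A pure set of the left part and a pure set
   of the right part form a pair of density 0 or 1, by double counting in the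
   finite graphs; this is perfect regularity.  Finitely many of the pure sets,
   read in the finite graphs themselves, give approximately perfect and strong
   regularity, and a failure of uniformity would be a sequence of graphs to
   which this applies.

   Conversely, a hereditary family that is not uniformly stable contains all
   half graphs, and each regularity fails for them: finitely many parts of a
   linear order cannot avoid a point that splits the two parts containing it in
   the middle, and a part of positive measure in an ultraproduct of half graphs
   meets both sides of some interval. *)

(** * Binary trees and half graphs *)

(** The tolerance [f N'] depends on the number of parts, so a partition has to be fixed before its
    tolerance is known. Purity makes this possible: it is an exact statement about null sets, so
    finitely many pure sets, their number determined by [eps] and the sequence of graphs, meet every
    positive tolerance in [U]-almost all of these graphs. The exceptional part can be compared with
    the first pure set for the same reason: that set is chosen before all others and has positive
    density.

    An impure set yields two halves of positive density but no control over the order of the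
    vertices that split it. Such splittings build a tree and not a half graph; the order is
    recovered afterwards by a Ramsey argument on trees, at the price of an exponential height.

    Everything up to finite regularity is done with ultralimits of densities. The measure enters
    only for perfect regularity, where parts are merely measurable and the measure on the product is
    characterized by internal sets alone; its value on measurable rectangles must be derived. *)

Section Shattering.
Variables X Y : Type.
Implicit Types (E : X -> Y -> Prop) (A : set X) (B : set Y).

(* A full binary tree of height [h]: inner nodes are labelled in [B], leaves
   in [A], and the branch to a leaf records its adjacency to the labels. *)
Fixpoint shattered E (h : nat) A B : Prop :=
  if h is h'.+1 then
    exists2 b, B b & shattered E h' (A `&` [set a | E a b]) B /\
                     shattered E h' (A `\` [set a | E a b]) B
  else A !=set0.

Lemma shatteredS E h A A' B B' : A `<=` A' -> B `<=` B' ->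
  shattered E h A B -> shattered E h A' B'.
Proof.
elim: h A A' => [|h IH] A A' AA' BB' /=; first by move=> [x /AA']; exists x.
move=> [b Bb [T1 T2]]; exists b; first exact: BB'.
by split; [apply: IH T1|apply: IH T2] => // x []; split => //; exact: AA'.
Qed.

Lemma shattered_nonempty E h A B : shattered E h A B -> A !=set0.
Proof.
by elim: h A => // h IH A [b _ [/IH[x [Ax _]] _]]; exists x.
Qed.

(** The colouring lemma. If the root label lies in [B], either both subtrees contain a tree labelled
    in [B] and one level lower than wanted, which the root joins, or one of them already contains a
    tree of height [k] labelled in [C]. A root label in [C] is symmetric. *)
Lemma shatteredU E h k A B C : shattered E (h + k) A (B `|` C) ->
  shattered E h A B \/ shattered E k A C.
Proof.
move: {2}(h + k)%N (leqnn (h + k)) => n.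
elim: n h k A => [|n IH] h k A hk T.
  by left; move: hk T; rewrite leqn0 addn_eq0 => /andP[/eqP-> /eqP->].
case: h hk T => [|h] hk T.
  by left; exact: (@shattered_nonempty E (0 + k) A (B `|` C)).
case: k hk T => [|k] hk T.
  by right; exact: (@shattered_nonempty E (h.+1 + 0) A (B `|` C)).
move: hk T; rewrite addSn ltnS => hk /= -[b Bb [T1 T2]].
have [bB|bC] := Bb.
  have [T1'|T1'] := IH _ _ _ hk T1; last first.
    by right; apply: (@shatteredS E k.+1) T1' => // x [].
  have [T2'|T2'] := IH _ _ _ hk T2; last first.
    by right; apply: (@shatteredS E k.+1) T2' => // x [].
  by left; exists b.
rewrite -addSnnS in hk T1 T2.
have [T1'|T1'] := IH _ _ _ hk T1.
  by left; apply: (@shatteredS E h.+1) T1' => // x [].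
have [T2'|T2'] := IH _ _ _ hk T2.
  by left; apply: (@shatteredS E h.+1) T2' => // x [].
by right; exists b.
Qed.

(** The chosen pair is the first of the order: later left points miss [b], later right points are
    joined to [a]. Shrinking [A] and [B] in this way matches the descent into a subtree. *)
Fixpoint half_graph E (r : nat) A B : Prop :=
  if r is r'.+1 then
    exists a b, [/\ A a, B b, E a b &
      half_graph E r' (A `&` [set x | ~ E x b]) (B `&` [set y | E a y])]
  else True.

Lemma half_graphS E r A A' B B' : A `<=` A' -> B `<=` B' ->
  half_graph E r A B -> half_graph E r A' B'.
Proof.
elim: r A A' B B' => //= r IH A A' B B' AA' BB' [a [b [Aa Bb ab H]]].
exists a, b; split; [exact: AA'|exact: BB'|by []|].
by apply: IH H => x []; split => //; [exact: AA'|exact: BB'].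
Qed.

Lemma half_graph_seq (x0 : X) (y0 : Y) E r A B : half_graph E r A B ->
  exists (a : nat -> X) (b : nat -> Y),
   forall i, (i < r)%N -> [/\ A (a i), B (b i) &
     forall j, (j < r)%N -> E (a i) (b j) <-> (i <= j)%N].
Proof.
elim: r A B => [|r IH] A B /=.
  by move=> _; exists (fun=> x0), (fun=> y0).
move=> [a0 [b0 [Aa Bb ab /IH[a [b H]]]]].
exists (fun i => if i is i'.+1 then a i' else a0).
exists (fun i => if i is i'.+1 then b i' else b0).
move=> [|i] ir.
  by split=> // -[|j] // jr; have [_ [_ ? _]] := H j jr; split.
have [[? ?] [? ?] Hi] := H i ir; split=> // -[|j] jr; last exact: Hi.
by split.
Qed.

(* Given an element [a] of [A], the colouring lemma leaves a tree labelled
   inside, or outside, the neighbourhood of [a]; its root [b] then lies on the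
   appropriate side of [a], and the recursion continues in one of the two
   subtrees.  The first kind of step extends a half graph of [E], the second
   one a half graph of the complement of [E]. *)
Lemma shattered_half_graph E r s A B :
  shattered E (iter (r + s) (fun h => h.+1.*2) 0) A B ->
  half_graph E r A B \/ half_graph (fun x y => ~ E x y) s A B.
Proof.
have [n] : exists n, n = (r + s)%N by exists (r + s)%N.
move=> rs; rewrite -rs; move: rs.
elim: n r s A B => [|n IH] [|r] [|s] A B //; try by left.
  by right.
move=> rs; rewrite iterS; set h := iter n _ _ => T.
have [a Aa] := shattered_nonempty T.
(* This explains the map [h.+1.*2]: colouring halves the height to [h.+1], and the root [b] takes
   one more level, leaving [h] for the recursion. *)
have : shattered E (h.+1 + h.+1)
    A ((B `&` [set y | E a y]) `|` (B `&` [set y | ~ E a y])).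
  rewrite addnn; apply: shatteredS T => // y By.
  by have [?|?] := pselect (E a y); [left|right].
move=> /shatteredU[] [b [Bb ab] [T1 T2]].
  have [|H|H] := IH r s.+1 _ _ _ T2; first by lia.
    left; exists a, b; split=> //; apply: half_graphS H => //.
  by right; apply: half_graphS H => x [].
have [|H|H] := IH r.+1 s _ _ _ T1; first by lia.
  by left; apply: half_graphS H => x [].
right; exists a, b; split=> //; apply: half_graphS H => // x [Ax /= xb].
by split => //; apply.
Qed.

(** In a half graph of the complement, [E (a i) (b j)] holds exactly when [j < i]. Reversing the
    indices and shifting those of [b] by one turns this into [i <= j]; the shift costs one pair,
    hence [d.+1]. *)
Lemma shattered_order E d A B :
  shattered E (iter (d + d.+1) (fun h => h.+1.*2) 0) A B ->
  exists (a : 'I_d -> X) (b : 'I_d -> Y),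
    forall i j : 'I_d, E (a i) (b j) <-> (i <= j)%N.
Proof.
move=> T; have [x0 _] := shattered_nonempty T.
have [y0 _] : exists y : Y, True.
  by move: T; rewrite addnS iterS doubleS => -[b _ _]; exists b.
have [H|H] := shattered_half_graph T.
  have [a [b ab]] := half_graph_seq x0 y0 H.
  exists (fun i => a i), (fun i => b i) => i j.
  by have [_ _] := ab i (ltn_ord i); exact.
have [a [b ab]] := half_graph_seq x0 y0 H.
exists (fun i : 'I_d => a (d - i)%N), (fun i : 'I_d => b (d - i.+1)%N) => i j.
have [|_ _ /(_ (d - j.+1)%N) H'] := ab (d - i)%N; first by lia.
have {}H' : ~ E (a (d - i)%N) (b (d - j.+1)%N) <-> (d - i <= d - j.+1)%N.
  by apply: H'; lia.
have ij : (d - i <= d - j.+1)%N = ~~ (i <= j)%N.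
  by have := ltn_ord i; have := ltn_ord j; lia.
rewrite ij in H'; split=> [e|le_ij].
  by apply/negPn/negP => /H'; apply.
by apply: contrapT => /H'; rewrite le_ij.
Qed.

End Shattering.

(** * Ultralimits of densities *)

Section UltraLimit.
Variables (R : realType) (U : set_system nat).
Context {UU : UltraFilter U}.

Lemma ultra_near_not (P : nat -> Prop) :
  ~ (\forall n \near U, P n) -> \forall n \near U, ~ P n.
Proof. by move=> nP; have [|] := in_ultra_setVsetC P UU. Qed.

Lemma ultra_near_or (P Q : nat -> Prop) :
  (\forall n \near U, P n \/ Q n) ->
  (\forall n \near U, P n) \/ (\forall n \near U, Q n).
Proof.
move=> PQ; have [|/ultra_near_not nP] := pselect (\forall n \near U, P n).
  by left.
by right; apply: filterS2 PQ nP => n [].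
Qed.

Lemma ultra_cvg (u : nat -> R) :
  (forall n, 0 <= u n <= 1) -> cvg (u n @[n --> U]).
Proof.
move=> u01; have uU : UltraFilter (u n @[n --> U]).
  split=> [|G GF uG]; first exact: fmap_proper_filter.
  rewrite eqEsubset; split=> // A GA.
  have [//|UnA] := in_ultra_setVsetC (u @^-1` A) UU.
  have /uG GnA : (u n @[n --> U]) (~` A) by [].
  by have /filter_ex[x []] : G (A `&` ~` A) by exact: filterI.
have := @segment_compact R 0 1.
rewrite compact_ultra => /(_ _ uU)[].
  by apply: (@filterE _ U _ (u @^-1` `[0, 1])) => n /=; rewrite in_itv/= u01.
by move=> p [_ up]; apply: cvgP up.
Qed.

(* The finiteness of the [T n] replaces the usual assumption that [U] is not
   principal. *)
Lemma saturation (T : nat -> nefinType) (P : nat -> forall n, T n -> Prop) :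
  (forall k, \forall n \near U, exists x, forall j, (j <= k)%N -> P j n x) ->
  exists x : forall n, T n, forall k, \forall n \near U, P k n (x n).
Proof.
move=> H.
(* In each [T n] take a point satisfying the longest initial list of conditions that can be
   satisfied there. If all initial lists can be satisfied, one point satisfies every condition:
   otherwise each [y] would fail some condition [f y], and the list up to the maximum of [f] would
   have no solution. *)
have choose n : exists x : T n, forall k,
    (exists y, forall j, (j <= k)%N -> P j n y) -> P k n x.
  have x0 : T n by exact: (enum_val (Ordinal (nef_gt0 (T n)))).
  have [allk|] := pselect (forall k, exists y, forall j, (j <= k)%N -> P j n y).
    apply: contrapT => /forallNP nx.
    have {}nx (y : T n) : exists k, ~ P k n y.
      have /existsNP[k /not_implyP[_ Pk]] := nx y.
      by exists k.
    have [f Pf] := choice nx.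
    have [y Py] := allk (\max_(y : T n) f y).
    by apply: (Pf y); apply: Py; exact: leq_bigmax.
  move=> /existsNP nall.
  have ex : exists k, ~~ `[< exists y, forall j, (j <= k)%N -> P j n y >].
    by have [k nk] := nall; exists k; apply/asboolPn.
  case: (ex_minnP ex) => -[|k] /asboolPn Pk mink.
    exists x0 => k [y Py]; exfalso; apply: Pk; exists y => j.
    by rewrite leqn0 => /eqP->; exact: Py.
  have /asboolP[y Py] : `[< exists y, forall j, (j <= k)%N -> P j n y >].
    by apply: contraT => /mink; rewrite ltnn.
  exists y => k' [z Pz]; apply: Py; rewrite leqNgt; apply/negP => kk'.
  by apply: Pk; exists z => j jk; apply: Pz; exact: leq_trans kk'.
exists (fun n => sval (cid (choose n))) => k.
by apply: filterS (H k) => n; case: cid => x /= Px; exact: Px.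
Qed.

End UltraLimit.

Section Density.
Variables (R : realType) (U : set_system nat).
Context {UU : UltraFilter U}.
Variable X : nat -> nefinType.
Implicit Types A B : forall n, {set X n}.

Definition dens A n : R := #|A n|%:R / #|X n|%:R.
Definition udens A : R := lim (dens A n @[n --> U]).

Lemma nef_gt0R n : 0 < #|X n|%:R :> R.
Proof. by rewrite ltr0n nef_gt0. Qed.

Lemma dens01 A n : 0 <= dens A n <= 1.
Proof.
rewrite /dens divr_ge0//= ler_pdivrMr ?nef_gt0R// mul1r ler_nat.
exact: max_card.
Qed.

Lemma dens_cvg A : dens A n @[n --> U] --> udens A.
Proof. by apply: ultra_cvg; exact: dens01. Qed.

Lemma udens_ge0 A : 0 <= udens A.
Proof.
apply: limr_ge; first exact: cvgP (@dens_cvg A).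
by near=> n; have /andP[] := dens01 A n.
Unshelve. all: by end_near. Qed.

Lemma udens_lim A l : dens A n @[n --> U] --> l -> udens A = l.
Proof. by move=> Al; apply: cvg_lim. Qed.

Lemma eq_udens A B : (\forall n \near U, A n = B n) -> udens A = udens B.
Proof.
move=> AB; apply: udens_lim; apply: (cvg_trans _ (@dens_cvg B)).
by apply: near_eq_cvg; apply: filterS AB => n; rewrite /dens => ->.
Qed.

Lemma udensID A B :
  udens A = udens (fun n => A n :&: B n)%SET + udens (fun n => A n :\: B n)%SET.
Proof.
apply: udens_lim; under eq_fun do rewrite /dens -(cardsID (B _)) natrD mulrDl.
by apply: cvgD; exact: dens_cvg.
Qed.

Lemma udens0 : udens (fun n => finset.set0) = 0.
Proof.
apply: udens_lim; under eq_fun do rewrite /dens cards0 mul0r.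
exact: cvg_cst.
Qed.

Lemma udensT : udens (fun n => [set: X n]%SET) = 1.
Proof.
apply: udens_lim; under eq_fun do rewrite /dens cardsT divff ?gt_eqF
  ?nef_gt0R//.
exact: cvg_cst.
Qed.

Lemma le_udens A B :
  (\forall n \near U, A n \subset B n) -> udens A <= udens B.
Proof.
move=> AB; rewrite (udensID B A); have -> : udens A = udens (fun n =>
  B n :&: A n)%SET.
  by apply: eq_udens; apply: filterS AB => n /finset.setIidPr.
by rewrite lerDl udens_ge0.
Qed.

Lemma udens_gt A c : c < udens A -> \forall n \near U, c < dens A n.
Proof. exact: cvgr_gt (@dens_cvg A) _. Qed.

Lemma udens_lt A c : udens A < c -> \forall n \near U, dens A n < c.
Proof. exact: cvgr_lt (@dens_cvg A) _. Qed.

Lemma udens_ge A c : (\forall n \near U, c <= dens A n) -> c <= udens A.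
Proof. by move=> cA; apply: limr_ge cA; exact: cvgP (@dens_cvg A). Qed.

Lemma udens_nonempty A : 0 < udens A -> \forall n \near U, A n != finset.set0.
Proof.
move=> /udens_gt; apply: filterS => n; rewrite /dens; apply: contraTneq => ->.
by rewrite cards0 mul0r ltxx.
Qed.

(** Saturation in the sets of subsets of [X n]: up to index [k], the conditions of lying below [A j]
    and having density at least [c - j.+1%:R^-1] are met by [A k] itself. This plays the role of
    continuity from above, with an internal set in place of the intersection. *)
Lemma udens_shrink (A : nat -> forall n, {set X n}) c :
  (forall k n, A k.+1 n \subset A k n) -> (forall k, c <= udens (A k)) ->
  exists B, (forall k, \forall n \near U, B n \subset A k n) /\ c <= udens B.
Proof.
move=> decr cA.
have mono n j k : (j <= k)%N -> A k n \subset A j n.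
  move=> /subnK <-; elim: (k - j)%N => // i IH.
  by rewrite addSn; apply: fintype.subset_trans IH; exact: decr.
have pw_gt0 n : (0 < #|{: {set X n}}|)%N by apply/card_gt0P; exists finset.set0.
pose pw n := @NEFin {set X n} (pw_gt0 n).
have [|B HB] := @saturation U UU pw
  (fun k n (B : {set X n}) => B \subset A k n /\ c - k.+1%:R^-1 <=
    #|B|%:R / #|X n|%:R).
  move=> k; have : c - k.+1%:R^-1 < udens (A k).
    by rewrite ltrBlDr (le_lt_trans (cA k))// ltrDl invr_gt0.
  move=> /udens_gt; apply: filterS => n Ak; exists (A k n) => j jk.
  split; first exact: mono.
  apply: le_trans (ltW Ak); rewrite lerD2l lerN2 lef_pV2 ?posrE// ler_nat.
  by [].
exists B; split=> [k|]; first by apply: filterS (HB k) => n [].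
apply/ler_addgt0Pl => e e0; rewrite -lerBlDl.
have [k _ ke] := @near_infty_natSinv_lt R (PosNum e0).
apply: (@le_trans _ _ (c - k.+1%:R^-1)).
  by rewrite lerD2l lerN2 ltW// (ke k)//=.
by apply: udens_ge; apply: filterS (HB k) => n [].
Qed.

End Density.

(** * Pure sets *)

Section PureSets.
Variables (R : realType) (U : set_system nat).
Context {UU : UltraFilter U}.
Variables (X Y : nat -> nefinType) (E : forall n, Y n -> {set X n}).
Implicit Types A B : forall n, {set X n}.
Local Notation udens := (@udens R U X).

(** The fibres range over all sequences [y], that is, over all points of the ultraproduct. [E] stays
    abstract so that [lfiber] and [rfiber] are both instances. *)
Definition pure A := forall y : forall n, Y n,
  udens (fun n => A n :&: E (y n))%SET = 0 \/
  udens (fun n => A n :\: E (y n))%SET = 0.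

Lemma eq_pure A B : (\forall n \near U, A n = B n) -> pure A -> pure B.
Proof.
move=> AB pA y.
have <- : udens (fun n => A n :&: E (y n))%SET = udens (fun n =>
  B n :&: E (y n))%SET.
  by apply: eq_udens; apply: filterS AB => n ->.
have <- // : udens (fun n => A n :\: E (y n))%SET = udens (fun n =>
  B n :\: E (y n))%SET.
by apply: eq_udens; apply: filterS AB => n ->.
Qed.

Lemma pure0 : pure (fun n => finset.set0).
Proof.
move=> y; left; rewrite -[RHS](@udens0 R U _ X); apply: eq_udens.
by apply: nearW => n; rewrite finset.set0I.
Qed.

(** If the bound failed at some vertex for [U]-many graphs, these vertices would form one sequence
    [y]. As [A] has at least half its limit density almost everywhere, both sides of its split by
    [y] would have limit density at least [d * (udens A / 2)], against purity at [y]. *)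
Lemma pure_fiber A (d : R) : pure A -> 0 < udens A -> 0 < d ->
  \forall n \near U, forall y : Y n, near01 d (fiber_density R (@E n) (A n) y).
Proof.
move=> pA A0 d0; apply: contrapT => /ultra_near_not bad.
have {bad} [y bad] : exists y : forall n, Y n, \forall n \near U,
    ~~ near01 d (fiber_density R (@E n) (A n) (y n)).
  pose bady n (y : Y n) := ~~ near01 d (fiber_density R (@E n) (A n) y).
  have y0 n : Y n by exact: (enum_val (Ordinal (nef_gt0 (Y n)))).
  have cy n : exists y, (exists y', bady n y') -> bady n y.
    have [[y' b]|nb] := pselect (exists y', bady n y'); first by exists y'.
    by exists (y0 n).
  exists (fun n => sval (cid (cy n))).
  apply: filterS bad => n /existsNP[y' /negP b].
  by case: cid => y /= by_; apply: by_; exists y'.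
pose c := d * (udens A / 2).
have c0 : 0 < c by rewrite mulr_gt0// divr_gt0.
have big : \forall n \near U, 0 < #|A n|%:R :> R /\
    c <= d * (#|A n|%:R / #|X n|%:R).
  have /udens_gt : udens A / 2 < udens A by rewrite gtr_pMr// invf_lt1// ltr1n.
  apply: filterS => n An; split.
    have := lt_trans (divr_gt0 A0 (ltr0n R 2)) An.
    by rewrite /dens pmulr_lgt0// invr_gt0 nef_gt0R.
  by rewrite ler_pM2l// ltW.
suff [c1 c2] : c <= udens (fun n => A n :&: E (y n))%SET /\
    c <= udens (fun n => A n :\: E (y n))%SET.
  by have [e|e] := pA y; [move: c1|move: c2]; rewrite e leNgt c0.
have split01 n : 0 < #|A n|%:R :> R ->
    ~~ near01 d (fiber_density R (@E n) (A n) (y n)) ->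
    d * #|A n|%:R <= #|(A n :&: E (y n))%SET|%:R /\
    d * #|A n|%:R <= #|(A n :\: E (y n))%SET|%:R.
  move=> An; rewrite /near01 /fiber_density negb_or !in_itv/= !negb_and.
  rewrite divr_ge0//= -!leNgt; set I := #|_ :&: _|.
  have I1 : I%:R / #|A n|%:R <= 1 :> R.
    rewrite ler_pdivrMr// mul1r ler_nat; exact/subset_leq_card/finset.subsetIl.
  rewrite I1 orbF ler_pdivlMr// ler_pdivrMr// => /andP[dI Id].
  split=> //.
  have := cardsID (E (y n)) (A n); rewrite -/I => /(congr1 (fun k => k%:R : R)).
  by rewrite natrD; lra.
split; apply: udens_ge; apply: filterS2 big bad =>
  n [An cn] /(split01 _ An)[b1 b2].
  by rewrite (le_trans cn)// mulrA ler_pM2r// invr_gt0 nef_gt0R.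
by rewrite (le_trans cn)// mulrA ler_pM2r// invr_gt0 nef_gt0R.
Qed.

Definition ultra_edge (x : forall n, X n) (y : forall n, Y n) :=
  \forall n \near U, x n \in E (y n).

Variable h : nat.
Hypothesis unshattered : ~ shattered ultra_edge h setT setT.

Lemma pure_subset A : 0 < udens A ->
  exists B, [/\ forall n, B n \subset A n, 0 < udens B & pure B].
Proof.
move=> A0; apply: contrapT => nB; apply: unshattered.
pose memU A : set (forall n, X n) := [set x | \forall n \near U, x n \in A n].
suff : shattered ultra_edge h (memU A) setT by exact: shatteredS.
(* Impurity is assumed of every positive internal subset of [A], not of [A] alone, so that both
   halves of a split inherit it. *)
have {nB} : forall B, (forall n, B n \subset A n) -> 0 < udens B -> ~ pure B.
  by move=> B BA B0 pB; apply: nB; exists B.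
elim: h A A0 => [|k IH] {}A A0 nA /=.
  have x0 n : X n by exact: (enum_val (Ordinal (nef_gt0 (X n)))).
  have cx n : exists x, (A n != finset.set0) -> x \in A n.
    by have [|/set0Pn[x xA]] := eqVneq (A n) finset.set0;
      [exists (x0 n)|exists x].
  exists (fun n => sval (cid (cx n))).
  by apply: filterS (udens_nonempty A0) => n An; case: cid => x /= ->.
have /existsNP[y /not_orP[y1 y2]] := nA A (fun=> subxx _) A0.
exists y => //; split.
  apply: (shatteredS _ _ (IH (fun n => A n :&: E (y n))%SET _ _)) => //.
  - move=> x xA; split; first by apply: filterS xA => n /finset.setIP[].
    by apply: filterS xA => n /finset.setIP[].
  - by rewrite lt_neqAle eq_sym udens_ge0 andbT; exact/eqP.
  - move=> B BA; apply: nA => n; apply: fintype.subset_trans (BA n) _.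
    exact: finset.subsetIl.
apply: (shatteredS _ _ (IH (fun n => A n :\: E (y n))%SET _ _)) => //.
- move=> x xA; split; first by apply: filterS xA => n /finset.setDP[].
  move=> xE; have /filter_ex[n []] : \forall n \near U, False.
    by apply: filterS2 xA xE => n /finset.setDP[_ /negP].
- by rewrite lt_neqAle eq_sym udens_ge0 andbT; exact/eqP.
- move=> B BA; apply: nA => n; apply: fintype.subset_trans (BA n) _.
  exact: finset.subsetDl.
Qed.

(** The supremum of the densities of pure subsets is not known to be attained, and more than half of
    it is enough for the greedy choice. The empty set is the default when that supremum is 0. *)
Lemma pure_half_max A : exists B, [/\ forall n, B n \subset A n, pure B,
  0 < udens B \/ B = (fun n => finset.set0) &
  forall C : forall n, {set X n}, (\forall n \near U, C n \subset A n) ->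
    pure C ->
    udens C <= 2 * udens B].
Proof.
pose S := [set udens C | C in [set C : forall n,
  {set X n} | (\forall n \near U, C n \subset A n) /\
                                        pure C]].
have S1 : ubound S 1.
  move=> _ [C _ <-]; rewrite -(udensT R X); apply: le_udens.
  by apply: nearW => n; exact: finset.subsetT.
have Ssup : has_sup S.
  split; last by exists 1.
  exists (udens (fun n => finset.set0)), (fun n => finset.set0) => //.
  by split; [apply: nearW => n; exact: finset.sub0set|exact: pure0].
have leS (C : forall n, {set X n}) : (\forall n \near U,
  C n \subset A n) -> pure C -> udens C <= sup S.
  by move=> CA pC; apply: ub_le_sup; [exists 1|exists C].
have [S0|S0] := leP (sup S) 0.
  exists (fun n => finset.set0); split=> //.
  - by move=> n; exact: finset.sub0set.
  - exact: pure0.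
  - by right.
  - by move=> C CA pC; rewrite udens0 mulr0 (le_trans (leS _ CA pC)).
have S2 : 0 < sup S / 2 by rewrite divr_gt0.
have [_ [C [CA pC] <-]] := sup_adherent S2 Ssup.
move=> SC; have CAC : \forall n \near U, C n = (C n :&: A n)%SET.
  by apply: filterS CA => n /finset.setIidPl.
(* Cutting [C] down to [A] changes it at negligible indices only and gives an inclusion at every
   index; the greedy parts are thereby disjoint in each finite graph. *)
exists (fun n => C n :&: A n)%SET; rewrite -(eq_udens R CAC); split.
- by move=> n; exact: finset.subsetIr.
- exact: eq_pure pC.
- by left; lra.
- by move=> D DA pD; have := leS _ DA pD; lra.
Qed.

(** Suppose the remainders keep density at least [e]. By [udens_shrink] some [S] of density at least
    [e] lies below all of them, and [S] contains a pure [B] of positive density. [B] was a candidate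
    at every stage, so every chosen set has at least half its density; infinitely many disjoint sets
    of that size do not fit in total density 1. *)
Lemma pure_exhaustion : exists A : nat -> forall n, {set X n},
  [/\ forall t, pure (A t),
      forall t, 0 < udens (A t) \/ A t = (fun n => finset.set0),
      0 < udens (A 0%N),
      forall n s t, s != t -> (A s n :&: A t n)%SET = finset.set0 &
      forall e, 0 < e -> exists T, forall T', (T <= T')%N ->
        udens (fun n => ~: \bigcup_(t < T') A t n)%SET < e].
Proof.
have [g /all_and4[gS gP g0 gmax]] := choice pure_half_max.
pose rest := fix rest k : forall n, {set X n} :=
  if k is k'.+1 then fun n => (rest k' n :\: g (rest k') n)%SET
  else fun n => [set: X n]%SET.
pose A k := g (rest k).
have restE k n : rest k n = (~: \bigcup_(t < k) A t n)%SET.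
  elim: k => [|k IH]; first by rewrite big_ord0 finset.setC0.
  by rewrite big_ord_recr/= IH finset.setCU finset.setDE.
have restS k n : rest k.+1 n \subset rest k n by exact: finset.subsetDl.
have rest_le n j k : (j <= k)%N -> rest k n \subset rest j n.
  move=> /subnK <-; elim: (k - j)%N => // i IH.
  by rewrite addSn; apply: fintype.subset_trans IH; exact: restS.
have Apos (S : forall n, {set X n}) : (forall k, \forall n \near U,
  S n \subset rest k n) ->
    0 < udens S -> exists2 c, 0 < c & forall k, c <= udens (A k).
  move=> Srest S0; have [B [BS B0 pB]] := pure_subset S0.
  exists (udens B / 2); first by rewrite divr_gt0.
  move=> k'; rewrite ler_pdivrMr// mulrC; apply: gmax => //.
  by apply: filterS (Srest k') => n; apply: fintype.subset_trans.
exists A; split=> //.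
- by move=> t; exact: gP.
- by move=> t; exact: g0.
- have T0 : 0 < udens (rest 0%N) by rewrite udensT.
  have [B [BS B0 pB]] := pure_subset T0.
  have AB : udens B <= 2 * udens (A 0%N) by apply: gmax => //; exact: nearW.
  by rewrite -(pmulr_rgt0 _ (ltr0n R 2)) (lt_le_trans B0).
- have lt_disj n s t : (s < t)%N -> (A s n :&: A t n)%SET = finset.set0.
    move=> st; apply/eqP; rewrite -finset.subset0.
    have : (A s n :&: A t n \subset A s n :&: rest s.+1 n)%SET.
      apply: finset.setIS; apply: fintype.subset_trans (gS _ n) _.
      exact: rest_le.
    by rewrite /= finset.setDE finset.setICA finset.setICr finset.setI0.
  move=> n s t; rewrite neq_ltn => /orP[|]; first exact: lt_disj.
  by rewrite finset.setIC; exact: lt_disj.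
- move=> e e0.
  suff [T rT] : exists T, udens (rest T) < e.
    exists T => T' TT'; apply: le_lt_trans rT; apply: le_udens.
    by apply: nearW => n; rewrite -restE; exact: rest_le.
  apply: contrapT => /forallNP nT.
  have [k|S [Srest eS]] := udens_shrink restS (c := e).
    by rewrite leNgt; apply/negP.
  have [c c0 cA] := Apos S Srest (lt_le_trans e0 eS).
  have sumA k : udens (rest k) <= 1 - k%:R * c.
    elim: k => [|k IH]; first by rewrite udensT mul0r subr0.
    have e1 : udens (rest k) = udens (A k) + udens (rest k.+1).
      rewrite (@udensID R U _ X (rest k) (A k)); congr (_ + _).
      by apply: eq_udens; apply: nearW => n; exact/finset.setIidPr/gS.
    by rewrite -natr1 mulrDl mul1r; have := cA k; lra.
  have [k _ /(_ k (leqnn _)) ke] := near_infty_natSinv_lt (PosNum c0).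
  have := sumA k.+1; have : 0 <= udens (rest k.+1) by exact: udens_ge0.
  have : 1 < k.+1%:R * c by rewrite -ltr_pdivrMl// mulr1.
  lra.
Qed.

End PureSets.

(** * Homogeneous pairs in finite graphs *)

Section FinitePairs.
Variable R : realType.

Lemma near01_div (e x y : R) : 0 <= x <= y -> 0 < y ->
  near01 e (x / y) = (x < e * y) || (y - x < e * y).
Proof.
move=> /andP[x0 xy] y0; rewrite /near01 !in_itv/= divr_ge0 ?(ltW y0)//=.
rewrite ltr_pdivrMr// ltr_pdivlMr// ler_pdivrMr// mul1r xy andbT.
by congr (_ || _); rewrite mulrBl mul1r ltrBlDr ltrBlDl addrC.
Qed.

Lemma card_setI_xor (T : finType) (S P Q : {set T}) :
  (#|S :&: P| <= #|S :&: Q| + #|S :&: [set x | (x \in P) != (x \in Q)]|)%SET%N.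
Proof.
apply: leq_trans (leq_card_setU _ _); apply: subset_leq_card.
apply/fintype.subsetP => x; rewrite !inE.
by case: (x \in S); case: (x \in P); case: (x \in Q).
Qed.

Lemma card_setX_lfiber (X Y : finType) (E : {set X * Y}) A B :
  #|finset.setX A B :&: E|%SET =
  (\sum_(b in B) #|A :&: [set a | (a, b) \in E]|%SET)%N.
Proof.
rewrite -sum1_card (eq_bigl (fun p => (p.1 \in A) && (p.2 \in B) && (p \in E))).
  rewrite big_mkcond (eq_bigr (fun p => (fun a b =>
    if (a \in A) && (b \in B) && ((a, b) \in E) then 1 else 0)%N p.1 p.2)).
    rewrite -(pair_bigA _ (fun a b =>
    if (a \in A) && (b \in B) && ((a,
      b) \in E) then 1 else 0)%N) exchange_big /=.
    rewrite [RHS]big_mkcond; apply: eq_bigr => b _.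
    case: ifPn => bB; last by rewrite big1// => a _; rewrite andbF.
    rewrite -big_mkcond sum1_card; apply: eq_card => a.
    by rewrite !inE unfold_in andbT.
  by case.
by move=> [a b]; rewrite !inE.
Qed.

Lemma card_setX_rfiber (X Y : finType) (E : {set X * Y}) A B :
  #|finset.setX A B :&: E|%SET =
  (\sum_(a in A) #|B :&: [set b | (a, b) \in E]|%SET)%N.
Proof.
have := card_setX_lfiber [set p : Y * X | (p.2, p.1) \in E]%SET B A.
under [in X in _ = X -> _]eq_bigr => a _.
  rewrite (_ : [set a0 | (a0, a) \in [set p | (p.2, p.1) \in E]]%SET =
    [set b | (a, b) \in E]%SET); last by apply/finset.setP => b; rewrite !inE.
  over.
move=> <-; pose sw (p : X * Y) := (p.2, p.1).
have sw_inj : injective sw by move=> [a b] [c d] [-> ->].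
rewrite -(card_imset _ sw_inj); apply: eq_card => -[b a].
rewrite !inE /=; apply/imsetP/idP => [[[a' b']]|].
  by rewrite !inE/= => /andP[/andP[? ?] ?] [-> ->]; apply/andP; split=> //;
    apply/andP.
by move=> /andP[/andP[? ?] ?]; exists (a, b) => //; rewrite !inE/=;
  apply/andP; split=> //; apply/andP.
Qed.

(** Compare [E] with [F], which contains the full column of [b] when the fibre of [b] is almost all
    of [A] and nothing of it otherwise. In each column they differ by at most [d * #|A|], so some
    row [a] has at most [d * #|B|] differences. The row of [E] at [a] is within [d] of empty or
    full, hence that of [F] is within [2 * d]; all rows of [F] agree, and returning from [F] to [E]
    costs the third [d]. *)
Lemma homogeneous_pair_fibers (X Y : finType) (E : {set X * Y}) (d : R)
    (A : {set X}) (B : {set Y}) :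
  (forall b, near01 d (fiber_density R (fun b => [set a | (a,
    b) \in E]%SET) A b)) ->
  (forall a, near01 d (fiber_density R (fun a => [set b | (a,
    b) \in E]%SET) B a)) ->
  homogeneous_pair E (3 * d) A B.
Proof.
move=> HA HB AB0; rewrite /pair_density.
have cAB : #|finset.setX A B|%:R =
  #|A|%:R * #|B|%:R :> R by rewrite cardsX natrM.
have /andP[A0 B0] : (0 < #|A|)%N && (0 < #|B|)%N.
  by rewrite -muln_gt0 -cardsX card_gt0.
have A0' : 0 < #|A|%:R :> R by rewrite ltr0n.
have B0' : 0 < #|B|%:R :> R by rewrite ltr0n.
have leI (T : finType) (S P : {set T}) : 0 <= (#|S :&: P|%SET%:R : R) <=
  #|S|%:R.
  by rewrite ler0n ler_nat subset_leq_card// finset.subsetIl.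
rewrite near01_div; last 2 first.
- by rewrite finset.setIC leI.
- by rewrite cAB mulr_gt0.
pose P b : bool := #|A|%:R - #|A :&: [set a | (a, b) \in E]|%SET%:R <
  d * #|A|%:R :> R.
pose F : {set X * Y} := [set p | P p.2]%SET.
pose D := [set p | (p \in E) != (p \in F)]%SET.
have DAB : #|finset.setX A B :&: D|%SET%:R <= d * #|A|%:R * #|B|%:R :> R.
  rewrite card_setX_lfiber natr_sum.
  apply: (@le_trans _ _ (\sum_(b in B) d * #|A|%:R)); last first.
    by rewrite sumr_const -[leLHS]mulr_natr.
  apply: ler_sum => b _; have := HA b.
  rewrite /fiber_density near01_div ?leI// => H.
  have [Pb|nPb] := boolP (P b).
    have -> : (A :&: [set a | (a, b) \in D])%SET =
        (A :\: [set a | (a, b) \in E])%SET.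
      by apply/finset.setP => a; rewrite !inE /= Pb; case: (_ \in E);
        rewrite ?andbF ?andbT.
    have /(congr1 (fun k => k%:R : R)) := cardsID [set a | (a, b) \in E]%SET A.
    by rewrite natrD; move: Pb; rewrite /P; lra.
  have -> : (A :&: [set a | (a, b) \in D])%SET = (A :&: [set a | (a,
    b) \in E])%SET.
    by apply/finset.setP => a; rewrite !inE /= (negbTE nPb); case: (_ \in E).
  by move: H; rewrite -/(P b) (negbTE nPb) orbF => /ltW.
have [a aA Da] : exists2 a, a \in A &
    #|B :&: [set b | (a, b) \in D]|%SET%:R <= d * #|B|%:R :> R.
  apply: contrapT => na; move: DAB; apply/negP; rewrite -ltNge.
  rewrite card_setX_rfiber natr_sum mulrAC [ltLHS]mulr_natr -sumr_const.
  apply: ltr_sum => [|a aA]; first by have /card_gt0P[a aA] := A0;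
    apply/hasP; exists a; rewrite ?mem_index_enum.
  by rewrite ltNge; apply/negP => h; apply: na; exists a.
pose Q := [set b | P b]%SET.
have xorl := card_setI_xor B [set b | (a, b) \in E]%SET Q.
have xorr := card_setI_xor B Q [set b | (a, b) \in E]%SET.
have DE : [set b | (b \in [set b | (a, b) \in E]%SET) != (b \in Q)]%SET =
    [set b | (a, b) \in D]%SET by apply/finset.setP => b; rewrite !inE.
have DE' : [set b | (b \in Q) != (b \in [set b | (a, b) \in E]%SET)]%SET =
    [set b | (a, b) \in D]%SET.
  by apply/finset.setP => b; rewrite !inE eq_sym.
rewrite DE in xorl; rewrite DE' in xorr.
have xorl2 := card_setI_xor (finset.setX A B) E F.
have xorr2 := card_setI_xor (finset.setX A B) F E.
have DF : [set p | (p \in F) != (p \in E)]%SET = D.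
  by apply/finset.setP => p; rewrite !inE eq_sym.
rewrite -/D in xorl2; rewrite DF in xorr2.
have ABF : #|finset.setX A B :&: F|%SET%:R = #|A|%:R * #|B :&: Q|%SET%:R :> R.
  rewrite -natrM -cardsX; congr _%:R; apply: eq_card => -[u v].
  by rewrite !inE /= andbA.
move: xorl xorr xorl2 xorr2; rewrite -!(ler_nat R) !natrD ABF.
have := HB a; rewrite /fiber_density near01_div ?leI// cAB (finset.setIC E).
set x := #|B :&: [set b | (a, b) \in E]|%SET%:R; set q := #|B :&: Q|%SET%:R.
move: Da DAB; set da := #|_|%:R; set dd := #|_|%:R; set e := #|_|%:R.
move=> Da DAB Hx xorl xorr xorl2 xorr2.
have {}Da : #|A|%:R * da <= #|A|%:R * (d * #|B|%:R) by rewrite ler_pM2l.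
case/orP: Hx => Hx.
  have : #|A|%:R * x < #|A|%:R * (d * #|B|%:R) by rewrite ltr_pM2l.
  have : #|A|%:R * q <= #|A|%:R * (x + da) by rewrite ler_pM2l.
  by move=> ? ?; apply/orP; left; lra.
have : #|A|%:R * (#|B|%:R - x) < #|A|%:R * (d * #|B|%:R) by rewrite ltr_pM2l.
have : #|A|%:R * x <= #|A|%:R * (q + da) by rewrite ler_pM2l.
by move=> ? ?; apply/orP; right; lra.
Qed.

End FinitePairs.

(** * Regularity of stable families *)

Section StableSequences.
Variables (R : realType) (U : set_system nat).
Context {UU : UltraFilter U}.
Variables (G : nat -> bigraph) (d : nat).
Hypothesis Gd : forall n, stable d (G n).

(** A half graph of sequences consists of finitely many relations, each decided by [U], so a single
    graph of the sequence realizes all of them. *)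
Lemma ultra_order_unstable (a : 'I_d -> forall n, lpart (G n))
    (b : 'I_d -> forall n, rpart (G n)) :
  ~ forall i j : 'I_d, (\forall n \near U, (a i n, b j n) \in edges (G n)) <->
                       (i <= j)%N.
Proof.
move=> ab.
have H (i j : 'I_d) : \forall n \near U,
    (a i n, b j n) \in edges (G n) <-> (i <= j)%N.
  have [ij|ij] := boolP (i <= j)%N.
    by have /(ab i j).2 := ij; apply: filterS => n ->.
  have /ultra_near_not : ~ \forall n \near U, (a i n, b j n) \in edges (G n).
    by move=> /ab; apply/negP.
  by apply: filterS => n.
have /filter_ex[n nab] : \forall n \near U, forall i j : 'I_d,
    (a i n, b j n) \in edges (G n) <-> (i <= j)%N.
  by apply: filter_forall => i; apply: filter_forall => j.
by apply: (Gd (n := n)); exists (fun i => a i n), (fun i => b i n).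
Qed.

Let height := iter (d + d.+1) (fun h => h.+1.*2) 0%N.

Lemma lfiber_unshattered :
  ~ shattered (ultra_edge U (fun n => @lfiber (G n))) height setT setT.
Proof.
move=> /shattered_order[a [b ab]]; apply: (@ultra_order_unstable a b) => i j.
by rewrite -ab /ultra_edge; under [in X in _ <-> X]eq_near do rewrite inE.
Qed.

(** Exchanging the two sides reverses the order of a half graph; reversing the indices on both sides
    restores it. *)
Lemma rfiber_unshattered :
  ~ shattered (ultra_edge U (fun n => @rfiber (G n))) height setT setT.
Proof.
move=> /shattered_order[a [b ab]].
apply: (@ultra_order_unstable (b \o @rev_ord d) (a \o @rev_ord d)) => i j.
have -> : (i <= j)%N = (rev_ord j <= rev_ord i)%N.
  by rewrite /=; have := ltn_ord i; have := ltn_ord j; lia.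
by rewrite -ab /ultra_edge; under [in X in _ <-> X]eq_near do rewrite inE.
Qed.

Lemma pure_homogeneous (A : forall n, {set lpart (G n)})
    (B : forall n, {set rpart (G n)}) (e : R) :
  pure R U (fun n => @lfiber (G n)) A -> pure R U (fun n => @rfiber (G n)) B ->
  0 < udens R U A -> 0 < udens R U B -> 0 < e ->
  \forall n \near U, homogeneous_pair (edges (G n)) e (A n) (B n).
Proof.
move=> pA pB A0 B0 e0; have e3 : 0 < e / 3 by rewrite divr_gt0.
apply: filterS2 (pure_fiber pA A0 e3) (pure_fiber pB B0 e3) => n An Bn.
by have -> : e = 3 * (e / 3);
  [rewrite mulrC divfK|exact: homogeneous_pair_fibers].
Qed.

End StableSequences.

Definition with_rest (T : finType) (k : nat) (A : nat -> {set T}) t : {set T} :=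
  if t is t'.+1 then A t' else (~: \bigcup_(t < k) A t)%SET.

Lemma with_rest_partition (T : finType) k (A : nat -> {set T}) :
  (forall s t, s != t -> (A s :&: A t)%SET = finset.set0) ->
  is_fpartition [set t | (t < k.+1)%N] (with_rest k A).
Proof.
move=> dA; split.
  have rA t : (t < k)%N -> (with_rest k A 0 :&: A t)%SET = finset.set0.
    move=> tk; apply/finset.setP => x; rewrite !inE.
    apply/negbTE/negP => /andP[/negP + xt]; apply.
    by apply/bigcupP; exists (Ordinal tk).
  apply/trivIsetP => -[|s] [|t] //= sk tk; rewrite ?eqSS => st; apply/seteqP;
    split=> // x /= [xs xt].
  - by have := rA t tk; move/setP/(_ x); rewrite !inE; rewrite !inE in xs xt;
    rewrite xs xt.
  - by have := rA s sk; move/setP/(_ x); rewrite !inE; rewrite !inE in xs xt;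
    rewrite xs xt.
  - by have := dA _ _ st; move/setP/(_ x); rewrite !inE xs xt.
apply/seteqP; split=> // x _.
have [/bigcupP[t _ xt]|xn] := boolP (x \in \bigcup_(t < k) A t)%SET.
  by exists t.+1 => //=; rewrite ltnS.
by exists 0%N => //=; rewrite inE.
Qed.

Section StableFamily.
Variables (R : realType) (F : bigraph -> Prop) (d : nat).
Hypothesis Fd : forall G, F G -> stable d G.

(** One partition serves for both approximately perfect and strong regularity. For a sequence in
    which [G N] refutes the bound [N], the number [T] of pure sets is fixed first; [f T.+1] is then
    a constant that the pure sets meet in [U]-many graphs. As [U] contains the cofinite sets, such a
    graph [G n] exists with [n > T], and its [T.+1] parts contradict its choice. *)
Lemma stable_family_regular (eps : R) (f : nat -> R) :
  0 < eps -> (forall n, 0 < f n) ->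
  exists N : nat, forall G, F G ->
  exists N' : nat, (1 < N' <= N)%N /\
  exists (A1 : nat -> {set lpart G}) (A2 : nat -> {set rpart G}),
  [/\ is_fpartition [set t | (t < N')%N] A1 /\
      is_fpartition [set t | (t < N')%N] A2,
      #|A1 0%N|%:R <= eps * #|A1 1%N|%:R /\
      #|A2 0%N|%:R <= eps * #|A2 1%N|%:R,
      forall t, (1 <= t < N')%N ->
        mostly_homogeneous (@lfiber G) (f N') (A1 t) /\
        mostly_homogeneous (@rfiber G) (f N') (A2 t) &
      forall t1 t2, (1 <= t1 < N')%N -> (1 <= t2 < N')%N ->
        homogeneous_pair (edges G) (f N') (A1 t1) (A2 t2)].
Proof.
move=> eps0 f0; apply: contrapT => /forallNP nN.
have {nN} [G HG] := choice (fun N => (existsNP _).2 (nN N)).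
have FG N : F (G N) by have /not_implyP[] := HG N.
have {}HG N := proj2 ((not_implyP _ _).1 (HG N)).
have [U [UU ooU]] := ultraFilterLemma eventually_filter.
have dG n : stable d (G n) by exact: Fd.
have [A [pA zA A0 dA restA]] := pure_exhaustion R (lfiber_unshattered dG).
have [B [pB zB B0 dB restB]] := pure_exhaustion R (rfiber_unshattered dG).
(* The factor one half leaves room to replace the limit density of [A 0] by its density in the
   finite graphs. *)
have [TA TAP] : exists T, forall T', (T <= T')%N ->
    udens R U (fun n => ~: \bigcup_(t < T') A t n)%SET <
      eps * (udens R U (A 0%N) / 2).
  by apply: restA; rewrite mulr_gt0// divr_gt0.
have [TB TBP] : exists T, forall T', (T <= T')%N ->
    udens R U (fun n => ~: \bigcup_(t < T') B t n)%SET <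
      eps * (udens R U (B 0%N) / 2).
  by apply: restB; rewrite mulr_gt0// divr_gt0.
(* Both sides need the same number of parts, and the successor ensures that the part of index 1,
   which is [A 0] or [B 0], exists. *)
pose T := (maxn TA TB).+1.
have fT := f0 T.+1.
have rest_small (X : nat -> nefinType) (C : nat -> forall n, {set X n}) :
    udens R U (fun n => ~: \bigcup_(t < T) C t n)%SET <
      eps * (udens R U (C 0%N) / 2) ->
    0 < udens R U (C 0%N) ->
    \forall n \near U, #|with_rest T (C^~ n) 0|%:R <= eps * #|C 0%N n|%:R :> R.
  move=> /udens_lt rC C0.
  have /udens_gt gC : udens R U (C 0%N) / 2 < udens R U (C 0%N).
    by rewrite gtr_pMr// invf_lt1// ltr1n.
  apply: filterS2 rC gC => n rC gC; 
  have := lt_trans rC (_ : _ < eps * dens R (C 0%N) n).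
  rewrite ltr_pM2l// => /(_ gC);
    rewrite /dens mulrA ltr_pM2r ?invr_gt0 ?nef_gt0R//.
  exact: ltW.
have hom1 (X Y : nat -> nefinType) (E : forall n, Y n -> {set X n})
    (C : nat -> forall n, {set X n}) :
    (forall t, pure R U E (C t)) ->
    (forall t, 0 < udens R U (C t) \/ C t = (fun n => finset.set0)) ->
    \forall n \near U, forall t : 'I_T,
      mostly_homogeneous (@E n) (f T.+1) (C t n).
  move=> pC zC; apply: filter_forall => t.
  have [Ct|Ct] := zC t; last by apply: nearW => n;
    rewrite Ct /mostly_homogeneous eqxx.
  apply: filterS (pure_fiber (pC t) Ct fT) => n hn _.
  rewrite (_ : [set b | _]%SET = finset.set0) ?cards0 ?mulr_ge0 ?(ltW fT)//.
  by apply/finset.setP => b; rewrite !inE hn.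
have hom2 : \forall n \near U, forall t1 t2 : 'I_T,
    homogeneous_pair (edges (G n)) (f T.+1) (A t1 n) (B t2 n).
  apply: filter_forall => t1; apply: filter_forall => t2.
  have [At|At] := zA t1; last first.
    by apply: nearW => n;
      rewrite At /homogeneous_pair -cards_eq0 cardsX cards0 mul0n eqxx.
  have [Bt|Bt] := zB t2; last first.
    by apply: nearW => n;
      rewrite Bt /homogeneous_pair -cards_eq0 cardsX cards0 muln0 eqxx.
  exact: pure_homogeneous.
have bigU : \forall n \near U, (T.+1 <= n)%N by apply: ooU;
  exact: nbhs_infty_ge.
have TAT : (TA <= T)%N by rewrite leqW ?leq_maxl.
have TBT : (TB <= T)%N by rewrite leqW ?leq_maxr.
have restAn := rest_small _ _ (TAP _ TAT) A0.
have restBn := rest_small _ _ (TBP _ TBT) B0.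
have homA := hom1 _ _ _ _ pA zA.
have homB := hom1 _ _ _ _ pB zB.
have [n [An Bn hA hB hAB]] : exists n, [/\
    #|with_rest T (A^~ n) 0|%:R <= eps * #|A 0%N n|%:R :> R,
    #|with_rest T (B^~ n) 0|%:R <= eps * #|B 0%N n|%:R :> R,
    forall t : 'I_T, mostly_homogeneous (@lfiber (G n)) (f T.+1) (A t n),
    forall t : 'I_T, mostly_homogeneous (@rfiber (G n)) (f T.+1) (B t n) &
    (forall t1 t2 : 'I_T,
      homogeneous_pair (edges (G n)) (f T.+1) (A t1 n) (B t2 n)) /\ (T < n)%N].
  apply: (@filter_ex _ U); near=> n.
  by split; [near: n..|split; near: n].
case: hAB => hAB Tn.
apply: (HG n); exists T.+1; split; first by rewrite Tn.
exists (with_rest T (A^~ n)), (with_rest T (B^~ n)); split.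
- by split; apply: with_rest_partition; [exact: dA|exact: dB].
- by split.
- move=> [|t]// tT; have {}tT : (t < T)%N by [].
  by split; [exact: (hA (Ordinal tT))|exact: (hB (Ordinal tT))].
- move=> [|t1] [|t2]// t1T t2T; have {}t1T : (t1 < T)%N by [].
  have {}t2T : (t2 < T)%N by [].
  exact: (hAB (Ordinal t1T) (Ordinal t2T)).
Unshelve. all: by end_near. Qed.

End StableFamily.

(** * Strong regularity implies regularity *)

Section FinitePartitions.
Variable T : finType.

Lemma card_fpartition lo n (A : nat -> {set T}) :
  is_fpartition [set t | (lo <= t < n)%N] A ->
  (\sum_(lo <= t < n) #|A t|)%N = #|T|.
Proof.
move=> [dA cA]; under eq_bigr do rewrite -sum1_card.
rewrite (eq_bigr (fun t => \sum_(x : T) (x \in A t : nat))%N); last first.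
  by move=> t _; rewrite big_mkcond; apply: eq_bigr => x _; case: ifP.
rewrite exchange_big /= -sum1_card; apply: eq_bigr => x _.
have [t /= tn xt] : (\bigcup_(t in [set t | (lo <= t < n)%N]) [set` A t]) x.
  by rewrite cA.
rewrite (bigD1_seq t)/= ?mem_index_iota ?iota_uniq// xt.
rewrite big1_seq ?addn0// => s /andP[st]; rewrite mem_index_iota => sn.
apply/eqP; rewrite eqb0; apply: contra st => xs; apply/eqP/dA => //.
by exists x.
Qed.

Lemma fpartition_part (D : set nat) (A : nat -> {set T}) x :
  is_fpartition D A -> exists2 t, D t & x \in A t.
Proof.
move=> [_ cA]; have [t Dt xt] : (\bigcup_(t in D) [set` A t]) x by rewrite cA.
by exists t.
Qed.

Lemma preimset_fpartition (T' : finType) (f : T' -> T) (D : set nat)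
    (A : nat -> {set T}) :
  is_fpartition D A -> is_fpartition D (fun t => f @^-1: A t)%SET.
Proof.
move=> [dA cA]; split.
  move=> s t Ds Dt [x /= []]; rewrite !inE => xs xt; apply: dA => //.
  by exists (f x).
apply/seteqP; split=> // x _.
have [t Dt xt] : (\bigcup_(t in D) [set` A t]) (f x) by rewrite cA.
by exists t => //=; rewrite inE.
Qed.

End FinitePartitions.

Section StrongStable.
Variable R : realType.

Lemma near01_le (e e' r : R) : e <= e' -> near01 e r -> near01 e' r.
Proof.
move=> ee'; rewrite /near01 !in_itv/= => /orP[/andP[-> re]|/andP[er ->]].
  by rewrite (lt_le_trans re).
by rewrite andbT; apply/orP; right; lra.
Qed.

Lemma near01_enlarge (T : finType) (E S S' : {set T}) (e c : R) :
  0 <= e -> S \subset S' -> (0 < #|S|)%N ->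
  #|S'|%:R - #|S|%:R <= c * #|S'|%:R ->
  near01 e (#|E :&: S|%SET%:R / #|S|%:R) ->
  near01 (e + c) (#|E :&: S'|%SET%:R / #|S'|%:R).
Proof.
move=> e0 SS' S0 cS; have S'0 := leq_trans S0 (subset_leq_card SS').
have leI (V : {set T}) : 0 <= (#|E :&: V|%SET%:R : R) <= #|V|%:R.
  by rewrite ler0n ler_nat subset_leq_card// finset.subsetIr.
rewrite !near01_div ?leI ?ltr0n//.
have SleS' : #|S|%:R <= #|S'|%:R :> R by rewrite ler_nat subset_leq_card.
have EleE : #|E :&: S|%SET%:R <= #|E :&: S'|%SET%:R :> R.
  by rewrite ler_nat subset_leq_card// finset.setIS.
have DleD : #|E :&: S'|%SET%:R - #|E :&: S|%SET%:R <= #|S'|%:R - #|S|%:R :> R.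
  rewrite lerBrDr addrAC lerBlDr -!natrD ler_nat.
  have := cardsID S (E :&: S')%SET; have := cardsID S S'.
  rewrite -finset.setIA (finset.setIidPr SS').
  have : (#|(E :&: S') :\: S| <= #|S' :\: S|)%SET%N.
    by rewrite subset_leq_card// finset.setSD// finset.subsetIr.
  lia.
have eS : e * #|S|%:R <= e * #|S'|%:R by rewrite ler_wpM2l.
by rewrite mulrDl => /orP[h|h]; apply/orP; [left|right]; lra.
Qed.

(** The exceptional part is absorbed by the part of index 1, with respect to which it is small, so
    no pair changes by more than a small proportion. *)
Lemma strong_stable_regularity_stable F :
  strong_stable_regularity R F -> stable_regularity R F.
Proof.
(* [eta] is both the constant value of [f], hence capped by 1, and the bound on the exceptional
   parts. Enlarging both sides adds at most [2 * eta] of the merged pair, estimated by [3 * eta];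
   with the tolerance [eta] this makes [4 * eta <= eps]. *)
move=> HF eps eps0; pose eta : R := Num.min eps 1 / 4.
have eta0 : 0 < eta by rewrite divr_gt0// lt_min eps0 ltr01.
have eta1 : eta <= 1 by rewrite ler_pdivrMr// ge_min; apply/orP; right; lra.
have eta4 : eta + 3 * eta <= eps.
  have -> : eta + 3 * eta = Num.min eps 1 by rewrite /eta; lra.
  by rewrite ge_min lexx.
have [|N HN] := HF eta (fun=> eta) eta0; first by move=> _; rewrite eta0.
exists N => G FG; have [N' [/andP[N'1 N'N] [A1 [A2 [[P1 P2] [r1 r2] hom]]]]]
  := HN G FG.
exists N'; split=> //.
pose merge (T : finType) (A : nat -> {set T}) t :=
  if t == 1%N then (A 0%N :|: A 1%N)%SET else A t.
have merge_part (T : finType) (A : nat -> {set T}) :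
    is_fpartition [set t | (t < N')%N] A ->
    is_fpartition [set t | (1 <= t < N')%N] (merge T A).
  move=> [dA cA].
  have N'0 : (0 < N')%N by exact: ltnW.
  split.
    have aux s t : t != 1%N -> (1 <= s < N')%N -> (1 <= t < N')%N ->
        [set` merge T A s] `&` [set` merge T A t] !=set0 -> s = t.
      move=> t1 /andP[s0 sN] /andP[t0 tN] [x /= []].
      rewrite /merge (negbTE t1); case: ifP => [/eqP->|_ xs xt]; last first.
        by apply: dA => //; exists x.
      rewrite inE => /orP[] xs xt.
        have t00 : 0%N = t by apply: dA => //; exists x.
        by rewrite -t00 in t0.
      by apply: dA => //; exists x.
    move=> s t; have [->|t1] := eqVneq t 1%N; last exact: aux.
    have [-> //|s1] := eqVneq s 1%N => sN tN; rewrite setIC => H.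
    exact/esym/aux.
  apply/seteqP; split=> // x _.
  have [t /= tN xt] : (\bigcup_(t in [set t | (t <
    N')%N]) [set` A t]) x by rewrite cA.
  case: t tN xt => [|[|t]] tN xt.
  - by exists 1%N => //=; rewrite inE xt.
  - by exists 1%N => //=; rewrite inE xt orbT.
  - by exists t.+2.
exists (merge _ A1), (merge _ A2); split;
  [exact: merge_part|exact: merge_part|].
have sub_merge (T : finType) (A : nat -> {set T}) t : A t \subset merge T A t.
  by rewrite /merge; case: ifP => [/eqP->|_]; rewrite ?finset.subsetUr.
have card_merge (T : finType) (A : nat -> {set T}) t :
    #|A 0%N|%:R <= eta * #|A 1%N|%:R ->
    #|merge T A t|%:R <= (1 + eta) * #|A t|%:R :> R.
  move=> rA; rewrite /merge; case: ifP => [/eqP->|_]; last first.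
    by rewrite ler_peMl// lerDl ltW.
  rewrite mulrDl mul1r; apply: (le_trans _ (lerD (lexx _) rA)).
  by rewrite -natrD ler_nat addnC leq_card_setU.
move=> t1 t2 t1N t2N ne.
have X1 := card_merge _ _ t1 r1; have X2 := card_merge _ _ t2 r2.
have : (0 < #|merge _ A1 t1| * #|merge _ A2 t2|)%N by rewrite -cardsX card_gt0.
rewrite muln_gt0 -!(ltr0n R) => /andP[m1 m2].
have a1 : 0 < #|A1 t1|%:R :> R by move: (lt_le_trans m1 X1);
  rewrite pmulr_rgt0//; lra.
have a2 : 0 < #|A2 t2|%:R :> R by move: (lt_le_trans m2 X2);
  rewrite pmulr_rgt0//; lra.
have AA : (0 < #|finset.setX (A1 t1) (A2 t2)|)%N.
  by rewrite cardsX muln_gt0 -!(ltr0n R) a1 a2.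
have h := hom t1 t2 t1N t2N; rewrite /homogeneous_pair -card_gt0 AA in h.
apply: near01_le eta4 _; apply: near01_enlarge AA _ (h isT); first exact: ltW.
  by apply/fintype.subsetP => -[x y]; rewrite !inE /= =>
    /andP[/(fintype.subsetP (sub_merge _ _ _))-> /(fintype.subsetP (sub_merge
      _ _ _))->].
rewrite !cardsX !natrM.
set y1 := #|A1 t1|%:R in X1 a1 *; set y2 := #|A2 t2|%:R in X2 a2 *.
set x1 := #|merge _ A1 t1|%:R in X1 m1 *; set x2 :=
  #|merge _ A2 t2|%:R in X2 m2 *.
have x1y1 : y1 <= x1 by rewrite ler_nat subset_leq_card.
have x2y2 : y2 <= x2 by rewrite ler_nat subset_leq_card.
have p1 : (x1 - y1) * x2 <= eta * y1 * x2 by rewrite ler_pM2r//; lra.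
have p2 : y1 * (x2 - y2) <= y1 * (eta * y2) by rewrite ler_pM2l//; lra.
have p3 : eta * y1 * x2 <= eta * x1 * x2 by rewrite ler_pM2r// ler_pM2l.
have p4 : y1 * (eta * y2) <= x1 * (eta * x2).
  have ? : eta * y2 <= eta * x2 by rewrite ler_pM2l.
  have ? : 0 <= eta * y2 by rewrite mulr_ge0 ?ltW.
  by apply: ler_pM => //; exact: ltW.
have : 0 <= eta * x1 * x2 by apply: mulr_ge0; [apply: mulr_ge0|]; exact: ltW.
lra.
Qed.

End StrongStable.

(** * Irregularity of half graphs *)

Definition half_graph_order m (G : bigraph) (a : 'I_m -> lpart G)
    (b : 'I_m -> rpart G) : Prop :=
  [/\ bijective a, bijective b &
      forall i j, ((a i, b j) \in edges G) = (i <= j)%N].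

(** The vertices that refute stability are distinct, since equal ones would be comparable in both
    directions, so they index the induced subgraph bijectively. The length [m.+1] keeps its parts
    nonempty. *)
Lemma unstable_half_graph (F : bigraph -> Prop) : hereditarily_closed F ->
  ~ (exists d, forall G, F G -> stable d G) ->
  forall m, exists (G : bigraph) (a : 'I_m.+1 -> lpart G) (b : 'I_m.+1 ->
    rpart G),
    F G /\ half_graph_order a b.
Proof.
move=> hF nF m; have /existsNP[G /not_implyP[FG]] := (forallNP _).2 nF m.+1.
move=> /contrapT[a [b ab]].
have a_inj : injective a.
  move=> i j aij; apply/val_inj/eqP; rewrite eqn_leq.
  by apply/andP; split; apply/ab; [rewrite aij|rewrite -aij]; apply/ab.
have b_inj : injective b.
  move=> i j bij; apply/val_inj/eqP; rewrite eqn_leq.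
  by apply/andP; split; apply/ab; [rewrite -bij|rewrite bij]; apply/ab.
pose A := [set a i | i : 'I_m.+1]%SET; pose B := [set b i | i : 'I_m.+1]%SET.
have A0 : A != finset.set0 by apply/set0Pn; exists (a ord0); exact: imset_f.
have B0 : B != finset.set0 by apply/set0Pn; exists (b ord0); exact: imset_f.
have aA i : a i \in A by exact: imset_f.
have bB i : b i \in B by exact: imset_f.
exists (Defs.induced A0 B0), (fun i => exist _ (a i) (aA i)), (fun i =>
  exist _ (b i) (bB i)).
split; first exact: hF.
split.
- apply: inj_card_bij => [i j [/a_inj]//|].
  by rewrite card_sig card_ord (leq_trans (leq_imset_card _ _))// card_ord.
- apply: inj_card_bij => [i j [/b_inj]//|].
  by rewrite card_sig card_ord (leq_trans (leq_imset_card _ _))// card_ord.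
- by move=> i j; rewrite inE /=; apply/idP/idP => /ab.
Qed.

(** * Counting in the half graph on ['I_m] *)

Section HalfGraphs.
Variable R : realType.

(** Take the element of largest rank in the counted set: the whole set ranks at or below it, so it
    has fewer than [c] elements. *)
Lemma card_low_rank (T : finType) (r : T -> R) (S : {set T}) (c : R) : 0 <= c ->
  #|[set p in S | #|[set x in S | r x <= r p]|%:R < c]|%SET%:R <= c.
Proof.
move=> c0; set K := [set p in S | _]%SET.
have [->|/set0Pn[k kK]] := eqVneq K finset.set0; first by rewrite cards0.
have [p + pmax] := @arg_maxP _ _ _ k [pred x in K] r kK.
rewrite /= inE => /andP[pS /ltW]; apply: le_trans.
rewrite ler_nat subset_leq_card//; apply/fintype.subsetP => x xK.
have rx : r x <= r p := pmax x xK.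
by rewrite inE rx andbT; move: xK; rewrite inE => /andP[].
Qed.

Variable m : nat.
Implicit Types S Q : {set 'I_m}.

Definition below S (p : 'I_m) := [set x in S | (x <= p)%N]%SET.
Definition above S (p : 'I_m) := [set x in S | (p <= x)%N]%SET.

Lemma card_low_below S (c : R) : 0 <= c ->
  #|[set p in S | #|below S p|%:R < c]|%SET%:R <= c.
Proof.
move=> c0; have := card_low_rank (fun p : 'I_m => p%:R) S c0.
congr (_%:R <= _); apply: eq_card => p; rewrite !inE; congr (_ && (_%:R < _)).
by apply: eq_card => x; rewrite !inE ler_nat.
Qed.

Lemma card_low_above S (c : R) : 0 <= c ->
  #|[set p in S | #|above S p|%:R < c]|%SET%:R <= c.
Proof.
move=> c0; have := card_low_rank (fun p : 'I_m => - p%:R) S c0.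
congr (_%:R <= _); apply: eq_card => p; rewrite !inE; congr (_ && (_%:R < _)).
by apply: eq_card => x; rewrite !inE lerN2 ler_nat.
Qed.

Lemma card_above S p : (#|above S p| <= (#|S :\: below S p|).+1)%SET%N.
Proof.
rewrite -addn1 addnC -(cards1 p); apply: leq_trans (leq_card_setU _ _).
apply: subset_leq_card; apply/fintype.subsetP => x; rewrite !inE =>
  /andP[-> px].
by rewrite /= andbT -ltnNge; move: px; rewrite leq_eqVlt =>
  /orP[/eqP/val_inj->|->]; rewrite ?eqxx ?orbT.
Qed.

(** The point [p] itself is not strictly above [p]; this is the [+ 1], which adds up to the number
    of parts in the counts below. *)
Lemma card_low_strictly_above S (c : R) : 0 <= c ->
  #|[set p in S | #|S :\: below S p|%:R < c]|%SET%:R <= c + 1.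
Proof.
move=> c0; have c1 : 0 <= c + 1 by rewrite addr_ge0.
apply: le_trans (card_low_above S c1); rewrite ler_nat subset_leq_card//.
apply/fintype.subsetP => p; rewrite !inE => /andP[-> pc] /=.
by apply: le_lt_trans (_ : (#|S :\: below S p|.+1)%SET%:R < _);
  rewrite ?ler_nat ?card_above// -natr1 ltrD2r.
Qed.

Definition half_edges : {set 'I_m * 'I_m} :=
  [set p : 'I_m * 'I_m | (p.1 <= p.2)%N]%SET.

(** If [p] were in the middle of both sets, the product of [below S p] and [above Q p] would consist
    of edges and that of [S :\: below S p] and [below Q p] of non-edges. Each is at least a [c ^+ 2]
    fraction of the pair. *)
Lemma half_graph_homogeneous_pair S Q (p : 'I_m) (c : R) : 0 < c ->
  homogeneous_pair half_edges (c ^+ 2) S Q -> p \in S -> p \in Q ->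
  [|| #|below S p|%:R < c * #|S|%:R, #|S :\: below S p|%SET%:R < c * #|S|%:R,
      #|above Q p|%:R < c * #|Q|%:R | #|below Q p|%:R < c * #|Q|%:R].
Proof.
move=> c0 hom pS pQ; have S0 : (0 < #|S|)%N by apply/card_gt0P; exists p.
have Q0 : (0 < #|Q|)%N by apply/card_gt0P; exists p.
apply/negPn/negP; rewrite !negb_or -!leNgt => /and4P[s1 s2 q1 q2].
have SQ0 : finset.setX S Q != finset.set0 by rewrite -card_gt0 cardsX muln_gt0
  S0.
have := hom SQ0; rewrite /pair_density near01_div; last 2 first.
- by rewrite ler0n ler_nat subset_leq_card// finset.subsetIr.
- by rewrite ltr0n card_gt0.
have cc (u v s q : nat) : c * s%:R <= u%:R -> c * q%:R <= v%:R ->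
    c ^+ 2 * (s * q)%:R <= (u * v)%:R.
  move=> su qv; rewrite !natrM expr2 mulrACA.
  by apply: ler_pM => //; rewrite mulr_ge0// ltW.
apply/negP; rewrite negb_or -!leNgt cardsX; apply/andP; split.
  apply: le_trans (cc _ _ _ _ s1 q1) _;
    rewrite -cardsX ler_nat subset_leq_card//.
  apply/fintype.subsetP => -[x y]; rewrite !inE /= =>
    /andP[/andP[-> xp] /andP[-> py]].
  by rewrite (leq_trans xp py).
apply: le_trans (cc _ _ _ _ s2 q2) _; rewrite -!cardsX lerBrDl -natrD ler_nat.
rewrite -[leqRHS](cardsID half_edges) finset.setIC leq_add2l subset_leq_card//.
apply/fintype.subsetP => -[x y]; rewrite !inE /=.
move=> /andP[/andP[xp xS] /andP[-> yp]]; rewrite xS /= andbT.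
by move: xp; rewrite xS /= -!ltnNge => /(leq_ltn_trans yp).
Qed.

(** Each [p] lies in some [S s] and some [Q t], and homogeneity of this pair puts [p] near an end of
    one of them. The sets in [K] collect such points, so they cover ['I_m], but they are too small
    to do so. *)
Lemma half_graph_not_stable_regular n (S Q : nat -> {set 'I_m}) :
  (2 * n < m)%N -> 
  is_fpartition [set t | (1 <= t < n)%N] S ->
  is_fpartition [set t | (1 <= t < n)%N] Q ->
  ~ forall s t, (1 <= s < n)%N -> (1 <= t < n)%N ->
    homogeneous_pair half_edges (64^-1 : R) (S s) (Q t).
Proof.
(* The four kinds of end points number at most [4 * c * m + n], that is [m / 2 + n], which is less
   than [m] as [2 * n < m]. The tolerance [64^-1] is [c ^+ 2]. *)
move=> nm pS pQ hom; pose c : R := 8^-1.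
have c0 : 0 < c by rewrite invr_gt0.
have c64 : (64^-1 : R) = c ^+ 2 by rewrite /c; lra.
rewrite c64 in hom.
pose K t : seq {set 'I_m} := [::
  [set p in S t | (#|below (S t) p|%:R < c * #|S t|%:R)%R]%SET;
  [set p in S t | (#|S t :\: below (S t) p|%SET%:R < c * #|S t|%:R)%R]%SET;
  [set p in Q t | (#|above (Q t) p|%:R < c * #|Q t|%:R)%R]%SET;
  [set p in Q t | (#|below (Q t) p|%:R < c * #|Q t|%:R)%R]%SET].
have cover : (m <= \sum_(1 <= t < n) \sum_(V <- K t) #|V|)%N.
  have cardE t V : V \in K t -> #|V| = (\sum_p (p \in V))%N.
    by move=> _; rewrite -sum1_card big_mkcond; apply: eq_bigr => p _;
      case: ifP.
  rewrite (eq_bigr (fun t => \sum_(V <- K t) \sum_p (p \in V))%N); last first.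
    by move=> t _; apply: eq_big_seq => V; exact: cardE.
  under eq_bigr do rewrite exchange_big.
  rewrite exchange_big -[leqLHS]card_ord -sum1_card; apply: leq_sum => p _.
  have [s /= sn ps] := fpartition_part p pS.
  have [t /= tn pt] := fpartition_part p pQ.
  rewrite lt0n sum_nat_seq_neq0.
  have mem V u : (1 <= u < n)%N -> V \in K u -> p \in V ->
      has (fun t => \sum_(V <- K t) (p \in V) != 0)%N (index_iota 1 n).
    move=> un VK pV; apply/hasP; exists u; first by rewrite mem_index_iota.
    by rewrite sum_nat_seq_neq0; apply/hasP; exists V; rewrite ?pV.
  have /or4P[h|h|h|h] := half_graph_homogeneous_pair c0 (hom s t sn tn) ps pt.
  - by apply: (mem (nth finset.set0 (K s) 0) s sn); rewrite ?mem_nth//= inE ps.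
  - by apply: (mem (nth finset.set0 (K s) 1) s sn); rewrite ?mem_nth//= inE ps.
  - by apply: (mem (nth finset.set0 (K t) 2) t tn); rewrite ?mem_nth//= inE pt.
  - by apply: (mem (nth finset.set0 (K t) 3) t tn); rewrite ?mem_nth//= inE pt.
have bound t : (\sum_(V <- K t) #|V|)%N%:R <=
  2 * c * #|S t|%:R + 2 * c * #|Q t|%:R + 1 :> R.
  rewrite /K !big_cons big_nil addn0 !natrD.
  have cS : 0 <= c * #|S t|%:R by rewrite mulr_ge0// ltW.
  have cQ : 0 <= c * #|Q t|%:R by rewrite mulr_ge0// ltW.
  have := card_low_below (S t) cS; have := card_low_strictly_above (S t) cS.
  have := card_low_above (Q t) cQ; have := card_low_below (Q t) cQ.
  lra.
have : m%:R <= 2 * c * m%:R + 2 * c * m%:R + n%:R :> R.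
  apply: (@le_trans _ _ (\sum_(1 <= t < n) \sum_(V <- K t) #|V|)%N%:R).
    by rewrite ler_nat.
  rewrite natr_sum; apply: (le_trans (ler_sum _ (fun t _ => bound t))).
  rewrite !big_split /= -!mulr_sumr -!natr_sum (card_fpartition pS)
    (card_fpartition pQ).
  by rewrite card_ord lerD2l sumr_const_nat ler_nat leq_subr.
have : (2 * n)%N%:R < m%:R :> R by rewrite ltr_nat.
rewrite natrM /c; lra.
Qed.

(** Read a point of [S t] as a right vertex: its fibre splits [S t] at that point. So the point is
    near an end of [S t], or it is one of the at most [e * m] exceptional vertices, whence [part].
    Summed over [t >= 1], with total size [s], this gives [s <= m / 8 + s / 4 + n]; as [4 * n < m],
    it forces [s < m / 2], whereas the part of index 0 has at most [m / 2] points. *)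
Lemma half_graph_not_approx_perfect n (S : nat -> {set 'I_m}) (e : R) :
  (4 * n < m)%N -> 0 <= e -> n.+1%:R * e <= 8^-1 ->
  is_fpartition [set t | (t < n)%N] S -> #|S 0%N|%:R <= 2^-1 * m%:R :> R ->
  ~ forall t, (1 <= t < n)%N -> S t != finset.set0 ->
    #|[set j | ~~ near01 e (#|below (S t) j|%:R / #|S t|%:R)]|%SET%:R <=
      e * m%:R.
Proof.
move=> nm e0 ne pS S0 hom.
have n0 : (0 < n)%N.
  have m0 : (0 < m)%N by exact: leq_ltn_trans nm.
  by have [t /= /(leq_ltn_trans _)->] := fpartition_part (Ordinal m0) pS.
have part t : (1 <= t < n)%N -> #|S t|%:R <= e * m%:R + 2 * e * #|S t|%:R + 1.
  move=> tn; have [->|St] := eqVneq (S t) finset.set0.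
    by rewrite cards0 mulr0 addr0 addr_ge0// mulr_ge0.
  have S_gt0 : (0 < #|S t|)%N by rewrite card_gt0.
  have c0 : 0 <= e * #|S t|%:R by rewrite mulr_ge0.
  have := hom t tn St; have := card_low_below (S t) c0.
  have := card_low_strictly_above (S t) c0.
  set L1 := [set p in S t | _]%SET; set L2 := [set p in S t | _]%SET.
  set L3 := [set j | _]%SET => h1 h2 h3.
  suff : #|S t|%:R <= #|L1|%:R + #|L2|%:R + #|L3|%:R :> R by lra.
  rewrite -!natrD ler_nat; apply: (@leq_trans #|(L1 :|: L2) :|: L3|%SET).
    apply: subset_leq_card; apply/fintype.subsetP => p pS'; rewrite !inE pS' /=.
    rewrite near01_div; last 2 first.
    - rewrite ler0n ler_nat subset_leq_card//; apply/fintype.subsetP => x.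
      by rewrite inE => /andP[].
    - by rewrite ltr0n.
    have -> : #|S t :\: below (S t) p|%SET%:R =
      #|S t|%:R - #|below (S t) p|%:R :> R.
      have := cardsID (below (S t) p) (S t).
      rewrite (_ : S t :&: below (S t) p = below (S t) p)%SET; last first.
        by apply/finset.setP => x; rewrite !inE andbA andbb.
      by move=> <-; rewrite natrD addrAC subrr add0r.
    by rewrite [X in X || _]orbC orbN.
  by rewrite (leq_trans (leq_card_setU _ _))// leq_add2r leq_card_setU.
have sumS : #|S 0%N|%:R + \sum_(1 <= t < n) #|S t|%:R = m%:R :> R.
  have := @card_fpartition _ 0 n S pS; rewrite card_ord big_ltn//.
  by move=> /(congr1 (fun k => k%:R : R)); rewrite natrD natr_sum.
set s := \sum_(1 <= t < n) _ in sumS.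
have : s <= n%:R * (e * m%:R) + 2 * e * s + n%:R.
  rewrite /s big_nat; apply: (le_trans (ler_sum _ part)).
  rewrite -!big_nat !big_split/= !sumr_const_nat -mulr_sumr.
  apply: lerD; last by rewrite ler_nat leq_subr.
  rewrite lerD2r.
  by rewrite -[leLHS]mulr_natl ler_wpM2r ?mulr_ge0// ler_nat leq_subr.
have e8 : e <= 8^-1 by apply: le_trans ne; rewrite ler_peMl// ler1n.
have nem : n%:R * (e * m%:R) <= 8^-1 * m%:R.
  rewrite mulrA ler_wpM2r//; apply: le_trans ne.
  by rewrite ler_wpM2r// ler_nat.
have s0 : 0 <= s by exact: sumr_ge0.
have es : e * s <= 8^-1 * s by rewrite ler_wpM2r.
have : (4 * n)%N%:R < m%:R :> R by rewrite ltr_nat.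
rewrite natrM; lra.
Qed.

End HalfGraphs.

(** * Reading a half graph through its enumerations *)

Section HalfGraphTransport.
Variables (R : realType) (m : nat) (G : bigraph).
Variables (a : 'I_m -> lpart G) (b : 'I_m -> rpart G).
Hypothesis abG : half_graph_order a b.

Lemma half_graph_preimset_pair e A B : homogeneous_pair (R :=
  R) (edges G) e A B ->
  homogeneous_pair (half_edges m) e (a @^-1: A)%SET (b @^-1: B)%SET.
Proof.
have [a_bij b_bij ab] := abG.
pose f (p : 'I_m * 'I_m) := (a p.1, b p.2).
have f_bij : bijective f.
  have [a' aK a'K] := a_bij; have [b' bK b'K] := b_bij.
  exists (fun p => (a' p.1, b' p.2)) => -[x y] /=.
    by rewrite aK bK.
  by rewrite /f /= a'K b'K.
have cardf (V : {set lpart G * rpart G}) : #|f @^-1: V|%SET = #|V|.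
  by apply: on_card_preimset; exact: onW_bij.
have XE : (f @^-1: finset.setX A B = finset.setX (a @^-1: A) (b @^-1: B))%SET.
  by apply/finset.setP => -[i j]; rewrite !inE.
have EE : (f @^-1: (edges G :&: finset.setX A B) =
    half_edges m :&: finset.setX (a @^-1: A) (b @^-1: B))%SET.
  by apply/finset.setP => -[i j]; rewrite !inE /= -ab.
rewrite /homogeneous_pair /pair_density -!card_gt0 -XE cardf.
by rewrite XE -EE !cardf.
Qed.

Lemma half_graph_preimset_mostly e A : mostly_homogeneous (R :=
  R) (@lfiber G) e A ->
  (a @^-1: A)%SET != finset.set0 ->
  #|[set j | ~~ near01 e (#|below (a @^-1: A)%SET j|%:R / #|a @^-1:
    A|%SET%:R)]|%SET%:R
    <= e * m%:R.
Proof.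
have [a_bij b_bij ab] := abG.
have carda (V : {set lpart G}) : #|a @^-1: V|%SET = #|V|.
  by apply: on_card_preimset; exact: onW_bij.
have cardb (V : {set rpart G}) : #|b @^-1: V|%SET = #|V|.
  by apply: on_card_preimset; exact: onW_bij.
rewrite /mostly_homogeneous -!card_gt0 carda => /[apply].
have -> : #|rpart G| =
  m by rewrite -cardsT -cardb -[RHS]card_ord -cardsT preimsetT.
apply: le_trans; rewrite -cardb ler_nat; apply: subset_leq_card.
apply/fintype.subsetP => j; rewrite !inE; apply: contra.
rewrite /fiber_density -[#|_ :&: _|%SET]carda.
congr near01; congr (_%:R / _); apply: eq_card => i.
by rewrite !inE ab.
Qed.

End HalfGraphTransport.

(** * Bounded stability from the regularity of finite graphs *)

Section RegularStable.
Variables (R : realType) (F : bigraph -> Prop).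
Hypothesis hF : hereditarily_closed F.

Lemma stable_regularity_bounded : stable_regularity R F ->
  exists d, forall G, F G -> stable d G.
Proof.
move=> HF; apply: contrapT => /(unstable_half_graph hF) half.
have [|N HN] := HF 64^-1; first by rewrite invr_gt0.
have [G [a [b [FG abG]]]] := half (2 * N)%N.
have [N' [N'N [A1 [A2 [P1 P2 hom]]]]] := HN G FG.
apply: (@half_graph_not_stable_regular R _ N' (fun t => a @^-1: A1 t)%SET
  (fun t => b @^-1: A2 t)%SET).
- by rewrite ltnS leq_mul2l N'N orbT.
- exact: preimset_fpartition.
- exact: preimset_fpartition.
- by move=> s t sN tN; apply: half_graph_preimset_pair => //; exact: hom.
Qed.

Lemma approximately_perfect_bounded :
  approximately_perfect_stable_regularity R F ->
  exists d, forall G, F G -> stable d G.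
Proof.
move=> HF; apply: contrapT => /(unstable_half_graph hF) half.
(* Chosen so that [n.+1%:R * f n = 8^-1]: the exceptional vertices of all parts together are at most
   an eighth of the side. *)
pose f n : R := (8 * n.+1)%:R^-1.
have f01 n : 0 < f n < 1.
  by rewrite invr_gt0 ltr0n muln_gt0/= invf_lt1 ?ltr1n ?ltr0n// mulnS.
have [|N HN] := HF 2^-1 f _ f01; first by rewrite invr_gt0.
have [G [a [b [FG abG]]]] := half (4 * N)%N.
have [N' [N'N [A1 [A2 [[P1 P2] [r1 r2] hom]]]]] := HN G FG.
have [a_bij _ _] := abG.
have carda (V : {set lpart G}) : #|a @^-1: V|%SET = #|V|.
  by apply: on_card_preimset; exact: onW_bij.
apply: (@half_graph_not_approx_perfect R _ N' (fun t =>
  a @^-1: A1 t)%SET (f N')).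
- by rewrite ltnS leq_mul2l N'N orbT.
- by have /andP[/ltW] := f01 N'.
- by rewrite /f natrM invfM mulrCA divff ?mulr1.
- exact: preimset_fpartition.
- rewrite carda (le_trans r1)// ler_pM2l ?invr_gt0// ler_nat.
  by rewrite -cardsT -carda preimsetT cardsT card_ord.
- by move=> t tN; apply: (half_graph_preimset_mostly abG); have [] := hom t tN.
Qed.

End RegularStable.

(** * The Loeb measure *)

Section InternalSets.
Variables (U : set_system nat) (UU : UltraFilter U) (T : nat -> nefinType).
Implicit Types A B : forall n, {set T n}.
Local Notation internal := (@internal_set U UU T).

Lemma ultra_class_repr (z : ultraproduct UU T) : ultra_class UU (repr z) = z.
Proof. exact: reprK. Qed.

Lemma internal_setP A (x : forall n, T n) :
  internal A (ultra_class UU x) <-> \forall n \near U, x n \in A n.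
Proof.
split=> [[y Ay /ultra_classP yx]|xA]; last by exists x.
by apply: filterS2 Ay yx => n + <-.
Qed.

Lemma internal_setPr A z : internal A z <-> \forall n \near U, repr z n \in A n.
Proof. by rewrite -{1}(ultra_class_repr z) internal_setP. Qed.

Lemma eq_internal_set A B : (\forall n \near U, A n = B n) ->
  internal A = internal B.
Proof.
move=> AB; apply/seteqP; split=> z /internal_setPr zA; apply/internal_setPr.
  by apply: filterS2 AB zA => n ->.
by apply: filterS2 AB zA => n ->.
Qed.

Lemma internal_setT : internal (fun n => [set: T n]%SET) = setT.
Proof.
apply/seteqP; split=> // z _; apply/internal_setPr.
by apply: nearW => n; rewrite inE.
Qed.

Lemma internal_set0 : internal (fun n => finset.set0) = set0.
Proof.
apply/seteqP; split=> // z /internal_setPr H; have /filter_ex[n] := H.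
by rewrite inE.
Qed.

Lemma internal_setC A : internal (fun n => ~: A n)%SET = ~` internal A.
Proof.
apply/seteqP; split=> z.
  move=> /internal_setPr zA /internal_setPr zB.
  have /filter_ex[n []] : \forall n \near U, False.
    by apply: filterS2 zA zB => n; rewrite inE => /negP.
move=> zA; apply/internal_setPr.
have /ultra_near_not : ~ \forall n \near U, repr z n \in A n.
  by move=> /internal_setPr.
by apply: filterS => n /negP; rewrite inE.
Qed.

Lemma internal_setI A B :
  internal (fun n => A n :&: B n)%SET = internal A `&` internal B.
Proof.
apply/seteqP; split=> z.
  move=> /internal_setPr zAB; split; apply/internal_setPr.
    by apply: filterS zAB => n /finset.setIP[].
  by apply: filterS zAB => n /finset.setIP[].
move=> [/internal_setPr zA /internal_setPr zB]; apply/internal_setPr.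
by apply: filterS2 zA zB => n ? ?; apply/finset.setIP.
Qed.

Lemma internal_setU A B :
  internal (fun n => A n :|: B n)%SET = internal A `|` internal B.
Proof.
rewrite -[RHS]setCK setCU -!internal_setC -internal_setI -internal_setC.
by apply: eq_internal_set; apply: nearW => n;
  rewrite -finset.setCU finset.setCK.
Qed.

Lemma internal_bigsetU k (S : nat -> forall n, {set T n}) :
  internal (fun n => \bigcup_(i < k) S i n)%SET = \big[setU/set0]_(i <
    k) internal (S i).
Proof.
elim: k => [|k IH].
  rewrite big_ord0 -internal_set0; apply: eq_internal_set.
  by apply: nearW => n; rewrite big_ord0.
rewrite big_ord_recr/= -IH -internal_setU; apply: eq_internal_set.
by apply: nearW => n; rewrite big_ord_recr.
Qed.

Lemma sub_internal_set A B :
  internal A `<=` internal B <-> \forall n \near U, A n \subset B n.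
Proof.
split=> [AB|AB z /internal_setPr zA]; last first.
  by apply/internal_setPr; apply: filterS2 AB zA => n /fintype.subsetP; exact.
apply: contrapT => /ultra_near_not nAB.
have cx n : exists x : T n, ~ (A n \subset B n) -> x \in (A n :\: B n)%SET.
  have [_|/fintype.subsetPn[x xA xB]] := boolP (A n \subset B n).
    by exists (enum_val (Ordinal (nef_gt0 (T n)))).
  by exists x; rewrite inE xA xB.
pose x n := sval (cid (cx n)).
have {nAB} xAB : \forall n \near U, x n \in (A n :\: B n)%SET.
  by apply: filterS nAB => n nAB; rewrite /x; case: cid => y /= /(_ nAB).
have /AB/internal_setP xB : internal A (ultra_class UU x).
  by apply/internal_setP; apply: filterS xAB => n /finset.setDP[].
have /filter_ex[n []] : \forall n \near U, False.
by apply: filterS2 xAB xB => n /finset.setDP[_ /negP].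
Qed.

Lemma internal_set_inj A B :
  internal A = internal B -> \forall n \near U, A n = B n.
Proof.
move=> /seteqP[/sub_internal_set AB /sub_internal_set BA].
by apply: filterS2 AB BA => n AB BA; apply/eqP; rewrite finset.eqEsubset AB.
Qed.

(** Were no finite union to contain [A], saturation would give a point of [A] outside every [S k].
    Through this, finite additivity of densities becomes countable additivity. *)
Lemma internal_compact (A : forall n, {set T n}) (S : nat -> forall n,
  {set T n}) :
  internal A `<=` \bigcup_k internal (S k) ->
  exists k, \forall n \near U, A n \subset (\bigcup_(i < k) S i n)%SET.
Proof.
move=> AS; apply: contrapT => /forallNP nk.
have [k|x xP] := @saturation U UU T
    (fun k n x => x \in A n /\ x \notin (\bigcup_(i < k) S i n)%SET).
  have /ultra_near_not := nk k.
  apply: filterS => n /negP/fintype.subsetPn[x xA xS]; exists x => j jk;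
    split=> //.
  apply: contra xS => /bigcupP[i _ xi]; apply/bigcupP.
  by exists (widen_ord jk i).
have [|k _ /internal_setP xk] := AS (ultra_class UU x).
  by apply/internal_setP; apply: filterS (xP 0%N) => n [].
have /filter_ex[n []] : \forall n \near U, False.
apply: filterS2 xk (xP k.+1) => n xk [_ /negP]; apply.
by apply/bigcupP; exists ord_max.
Qed.

End InternalSets.

(* A copy of the ultraproduct, to carry the algebra of internal sets. *)
Definition loeb (U : set_system nat) (UU : UltraFilter U) (T : nat ->
  nefinType) :
  Type := ultraproduct UU T.

Section LoebMeasure.
Variables (R : realType) (U : set_system nat) (UU : UltraFilter U).
Variable T : nat -> nefinType.
Local Notation internal := (@internal_set U UU T).
Local Notation internals := (@internal_sets U UU T).

Lemma internal_sets_setU : setU_closed internals.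
Proof.
by move=> _ _ [A _ <-] [B _ <-]; exists (fun n => A n :|: B n)%SET;
  rewrite ?internal_setU.
Qed.

Lemma internal_sets_setC : setC_closed internals.
Proof.
by move=> _ [A _ <-]; exists (fun n => ~: A n)%SET; rewrite ?internal_setC.
Qed.

Lemma internal_sets_set0 : internals set0.
Proof. by exists (fun n => finset.set0); rewrite ?internal_set0. Qed.

HB.instance Definition _ := Pointed.on (loeb UU T).

HB.instance Definition _ :=
  @isAlgebraOfSets.Build default_measure_display (loeb UU T) internals
    internal_sets_set0 internal_sets_setU internal_sets_setC.

(** The density of some sequence representing [A]; two such sequences agree at [U]-almost all
    indices, so the choice is immaterial. The value 0 off the internal sets is a default. *)
Definition loeb_content (A : set (loeb UU T)) : \bar R :=
  if pselect (internals A) is left h then (udens R U (sval (cid2 h)))%:E else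
    0%E.

Lemma loeb_contentE A : loeb_content (internal A) = (udens R U A)%:E.
Proof.
rewrite /loeb_content; case: pselect => [h|]; last by case; exists A.
by case: cid2 => B /= _ /internal_set_inj BA; rewrite (eq_udens R BA).
Qed.

Lemma loeb_content0 : loeb_content set0 = 0%E.
Proof. by rewrite -internal_set0 loeb_contentE udens0. Qed.

Lemma loeb_content_ge0 A : (0 <= loeb_content A)%E.
Proof. by rewrite /loeb_content; case: pselect => // h;
  rewrite lee_fin udens_ge0. Qed.

Lemma udensU (A B : forall n, {set T n}) :
  (\forall n \near U, (A n :&: B n = finset.set0)%SET) ->
  udens R U (fun n => A n :|: B n)%SET = udens R U A + udens R U B.
Proof.
move=> AB; rewrite (udensID R _ A); congr (_ + _); apply: eq_udens.
  by apply: nearW => n; rewrite finset.setUK.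
apply: filterS AB => n AB; rewrite finset.setDUl finset.setDv finset.set0U.
by apply/finset.setDidPl; rewrite -finset.setI_eq0 finset.setIC AB.
Qed.

(** By compactness finitely many members of a disjoint internal cover already fill the internal set
    [W], so the partial sums are eventually constant. *)
Lemma loeb_content_sigma_additive : semi_sigma_additive loeb_content.
Proof.
move=> F mF tF [W _ WF].
have [S SF] : exists S : nat -> forall n, {set T n}, forall i,
  internal (S i) = F i.
  by have /choice[S SF] : forall i, exists S, internal S = F i; [
    move=> i; have [S _ <-] := mF i; exists S|exists S].
have {}tF : trivIset setT (internal \o S).
  by move=> i j _ _; rewrite /= !SF; exact: tF.
have sumF k : (\sum_(0 <= i < k) loeb_content (F i) =
    (udens R U (fun n => \bigcup_(i < k) S i n)%SET)%:E)%E.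
  elim: k => [|k IH].
    by rewrite big_geq// -loeb_contentE internal_bigsetU big_ord0 loeb_content0.
  rewrite big_nat_recr//= IH -SF loeb_contentE -EFinD -udensU.
    by congr EFin; apply: eq_udens; apply: nearW => n; rewrite big_ord_recr.
  apply: internal_set_inj; rewrite internal_set0 internal_setI internal_bigsetU.
  rewrite big_distrl/= big1// => i _.
  move/trivIsetP : tF => /(_ i k Logic.I Logic.I); apply.
  by rewrite neq_ltn ltn_ord.
have [|k Wk] := @internal_compact U UU T W S.
  by rewrite WF => z [i _]; rewrite -SF => zi; exists i.
rewrite -WF loeb_contentE; apply: cvg_near_cst.
near=> j; rewrite sumF; congr EFin; apply: eq_udens; apply: internal_set_inj.
apply/seteqP; split.
  rewrite WF internal_bigsetU -(bigcup_mkord j (fun i =>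
    internal (S i))) => z [i _] zi; exists i => //.
  by rewrite -SF.
apply/sub_internal_set; apply: filterS Wk => n Wk;
  apply: fintype.subset_trans Wk _.
apply/bigcupsP => i _; have kj : (k <= j)%N by near: j; exact: nbhs_infty_ge.
exact: (finset.bigcup_sup (widen_ord kj i)).
Unshelve. all: by end_near. Qed.

HB.instance Definition _ := isMeasure.Build _ _ _ loeb_content
  loeb_content0 loeb_content_ge0 loeb_content_sigma_additive.

Let loeb_measure := measure_extension loeb_content.

HB.instance Definition _ := Measure.on loeb_measure.

Let loeb_measureE A : loeb_measure (internal A) = (udens R U A)%:E.
Proof.
rewrite -loeb_contentE; apply: measurable_mu_extE.
by have : internals (internal A) by exists A.
Qed.

Let loeb_measureT : loeb_measure setT = 1%E.
Proof. by rewrite -internal_setT loeb_measureE udensT. Qed.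

HB.instance Definition _ :=
  Measure_isProbability.Build _ _ _ loeb_measure loeb_measureT.

Lemma loeb_measure_exists :
  exists mu : probability (g_sigma_algebraType internals) R,
    is_ultraproduct_measure mu.
Proof.
(* The measurable sets of [loeb] are the internal sets, so the extension already lives on the
   required sigma-algebra. *)
exists (loeb_measure :
  probability (g_sigma_algebraType (@measurable _ (loeb UU T))) R).
move=> A /=; rewrite loeb_measureE; apply: cvg_EFin;
  [exact: nearW|exact: dens_cvg].
Qed.

End LoebMeasure.

(** * Perfect regularity of stable ultraproducts *)

Section UltraproductMeasure.
Variables (R : realType) (U : set_system nat) (UU : UltraFilter U).
Variable T : nat -> nefinType.
Variable mu : probability (g_sigma_algebraType (@internal_sets U UU T)) R.
Hypothesis muP : is_ultraproduct_measure mu.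

Lemma ultraproduct_measureE A : mu (@internal_set U UU _ A) = (udens R U A)%:E.
Proof.
rewrite -(cvg_lim _ (@muP A)); last exact: ereal_hausdorff.
apply: cvg_lim; first exact: ereal_hausdorff.
by apply: cvg_EFin; [exact: nearW|exact: dens_cvg].
Qed.

Lemma measurable_internal A :
  (@internal_sets U UU T).-sigma.-measurable (@internal_set U UU _ A).
Proof. by apply: sub_sigma_algebra; exists A. Qed.

End UltraproductMeasure.

Section Rectangles.
Variables (U : set_system nat) (UU : UltraFilter U).
Variables (X Y : nat -> nefinType).
Local Notation XY := (fun n => nef_prod (X n) (Y n)).
Local Notation measurableX := (@internal_sets U UU X).-sigma.-measurable.
Local Notation measurableY := (@internal_sets U UU Y).-sigma.-measurable.
Local Notation measurableXY := (@internal_sets U UU XY).-sigma.-measurable.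

Lemma ultra_rect_internal A B :
  ultra_rect (@internal_set U UU _ A) (@internal_set U UU _ B) =
  @internal_set U UU XY (fun n => finset.setX (A n) (B n)).
Proof.
apply/seteqP; split=> z.
  move=> [/internal_setP zA /internal_setP zB]; apply/internal_setPr.
  by apply: filterS2 zA zB => n ? ?; rewrite inE; apply/andP.
move=> /internal_setPr zAB; split; apply/internal_setP.
  by apply: filterS zAB => n; rewrite inE => /andP[].
by apply: filterS zAB => n; rewrite inE => /andP[].
Qed.

Lemma measurable_ultra_fst :
  measurable_fun [set: g_sigma_algebraType (@internal_sets U UU XY)]
    (ultra_map (fun n => @nef_fst (X n) (Y n)) :
       _ -> g_sigma_algebraType (@internal_sets U UU X)).
Proof.
apply: (@measurability _ _ (g_sigma_algebraType (@internal_sets U UU XY))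
  (g_sigma_algebraType (@internal_sets U UU X)) setT _ (@internal_sets U UU
    X)) => //.
move=> _ [_ [A _ <-] <-]; rewrite setTI.
apply: sub_sigma_algebra; exists (fun n =>
  finset.setX (A n) [set: Y n]%SET) => //.
rewrite -ultra_rect_internal; apply/seteqP; split=> z; first by case.
by move=> zA; split=> //; rewrite internal_setT.
Qed.

Lemma measurable_ultra_snd :
  measurable_fun [set: g_sigma_algebraType (@internal_sets U UU XY)]
    (ultra_map (fun n => @nef_snd (X n) (Y n)) :
       _ -> g_sigma_algebraType (@internal_sets U UU Y)).
Proof.
apply: (@measurability _ _ (g_sigma_algebraType (@internal_sets U UU XY))
  (g_sigma_algebraType (@internal_sets U UU Y)) setT _ (@internal_sets U UU
    Y)) => //.
move=> _ [_ [A _ <-] <-]; rewrite setTI.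
apply: sub_sigma_algebra; exists (fun n =>
  finset.setX [set: X n]%SET (A n)) => //.
rewrite -ultra_rect_internal; apply/seteqP; split=> z; first by case.
by move=> zA; split=> //; rewrite internal_setT.
Qed.

Lemma measurable_ultra_rect A B : measurableX A -> measurableY B ->
  measurableXY (ultra_rect A B).
Proof.
move=> mA mB; apply: measurableI.
  by rewrite -[X in measurable X]setTI; exact: measurable_ultra_fst.
by rewrite -[X in measurable X]setTI; exact: measurable_ultra_snd.
Qed.

End Rectangles.

Lemma udens_setX (R : realType) (U : set_system nat) (UU : UltraFilter U)
    (X Y : nat -> nefinType) (A : forall n, {set X n}) (B : forall n,
      {set Y n}) :
  @udens R U (fun n => nef_prod (X n) (Y n)) (fun n =>
    finset.setX (A n) (B n)) =
  udens R U A * udens R U B.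
Proof.
apply: udens_lim; rewrite (_ : (fun n => _) = (fun n =>
  dens R A n * dens R B n)).
  by apply: cvgM; exact: dens_cvg.
by apply/funext => n; rewrite /dens cardsX card_prod !natrM mulf_div.
Qed.

Lemma udens_le_scale (R : realType) (U : set_system nat) (UU : UltraFilter U)
    (T : nat -> nefinType) (A B : forall n, {set T n}) (c : R) :
  (\forall n \near U, #|A n|%:R <= c * #|B n|%:R) -> udens R U A <=
    c * udens R U B.
Proof.
move=> AB; have cB : c * dens R B n @[n --> U] --> c * udens R U B.
  by apply: cvgM; [exact: cvg_cst|exact: dens_cvg].
rewrite -(cvg_lim _ cB)//; apply: ler_lim;
  [exact: cvgP (@dens_cvg R U UU T A)|exact: cvgP cB|].
by apply: filterS AB => n AB; rewrite /dens mulrA ler_pM2r// invr_gt0 nef_gt0R.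
Qed.

(** For each [e] the ultrafilter decides which alternative holds. If both limits were positive, an
    [e] below both would contradict either decision. *)
Lemma udens_zero_one (R : realType) (U : set_system nat) (UU : UltraFilter U)
    (T : nat -> nefinType) (S V : forall n, {set T n}) :
  (forall e : R, 0 < e -> \forall n \near U,
     #|S n :&: V n|%SET%:R <= e * #|S n|%:R \/
     #|S n :\: V n|%SET%:R <= e * #|S n|%:R) ->
  udens R U (fun n => S n :&: V n)%SET = 0 \/ udens R U (fun n =>
    S n :\: V n)%SET = 0.
Proof.
move=> H; set u := udens _ _ _; set v := udens _ _ _.
have [->|u0] := eqVneq u 0; first by left.
have [->|v0] := eqVneq v 0; first by right.
have {}u0 : 0 < u by rewrite lt_neqAle eq_sym u0 udens_ge0.
have {}v0 : 0 < v by rewrite lt_neqAle eq_sym v0 udens_ge0.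
have S1 : udens R U S <= 1.
  by rewrite -(udensT R T); apply: le_udens; apply: nearW => n;
    exact: finset.subsetT.
have [e e0 [eu ev]] : exists2 e, 0 < e & e < u /\ e < v.
  by have [uv|uv] := leP u v; [exists (u / 2); lra|exists (v / 2); lra].
have eS : e * udens R U S <= e by rewrite ler_piMr// ltW.
have [/udens_le_scale|/udens_le_scale] := ultra_near_or (H e e0).
  by rewrite -/u => ue; lra.
by rewrite -/v => ve; lra.
Qed.

Section StablePerfect.
Variables (R : realType) (U : set_system nat) (UU : UltraFilter U).
Variables (G : nat -> bigraph) (d : nat).
Hypothesis Gd : forall n, stable d (G n).
Local Notation X := (fun n => lpart (G n)).
Local Notation Y := (fun n => rpart (G n)).
Local Notation XY := (fun n => nef_prod (lpart (G n)) (rpart (G n))).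

(** Index 0 takes what no [A k] covers, a measurable set that need not be internal. *)
Definition internal_parts (T : nat -> nefinType) (A : nat -> forall n,
  {set T n}) t :=
  if t is t'.+1 then @internal_set U UU _ (A t')
  else ~` \bigcup_k @internal_set U UU _ (A k).

Lemma internal_parts_partition (T : nat -> nefinType) (A : nat -> forall n,
  {set T n}) :
  (forall n s t, s != t -> (A s n :&: A t n)%SET = finset.set0) ->
  is_partition setT (internal_parts A).
Proof.
move=> dA; split.
  apply/trivIsetP => -[|s] [|t] //= _ _; rewrite ?eqSS => st.
  - by apply/seteqP; split=> // z [nz zt]; apply: nz; exists t.
  - by apply/seteqP; split=> // z [zs nz]; apply: nz; exists s.
  - rewrite -internal_setI -internal_set0; apply: eq_internal_set.
    by apply: nearW => n; exact: dA.
apply/seteqP; split=> // z _.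
have [[k _ zk]|nz] := pselect ((\bigcup_k @internal_set U UU _ (A k)) z).
  by exists k.+1.
by exists 0%N.
Qed.

Lemma measurable_internal_parts (T : nat -> nefinType) (A : nat -> forall n,
  {set T n}) t :
  (@internal_sets U UU T).-sigma.-measurable (internal_parts A t).
Proof.
case: t => [|t]; last exact: measurable_internal.
apply: measurableC; apply: bigcupT_measurable => k; exact: measurable_internal.
Qed.

Lemma internal_parts_rest (T : nat -> nefinType) (A : nat -> forall n,
  {set T n}) k :
  internal_parts A 0 `<=` @internal_set U UU T (fun n => ~: \bigcup_(i <
    k) A i n)%SET.
Proof.
rewrite internal_setC internal_bigsetU => z nz zk; apply: nz.
move: zk; rewrite -(bigcup_mkord k (fun i => @internal_set U UU T (A i))).
by move=> [i _ zi]; exists i.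
Qed.

Lemma stable_perfect_regular : perfect_stable_regularity UU R G.
Proof.
have [mu muP] := loeb_measure_exists R UU XY.
exists mu; split=> //.
have [A [pA zA A0 dA restA]] := pure_exhaustion R (lfiber_unshattered Gd).
have [B [pB zB B0 dB restB]] := pure_exhaustion R (rfiber_unshattered Gd).
exists (internal_parts A), (internal_parts B); split.
- by split; apply: internal_parts_partition.
- exact: measurable_internal_parts.
- exact: measurable_internal_parts.
pose muE := ultraproduct_measureE muP.
(* Only internal sets have a computed measure, so a set is shown to be null through internal
   supersets of arbitrarily small density. *)
have mu_null (C : set (ultraproduct UU XY)) (D : nat -> forall n, {set XY n}) :
    (@internal_sets U UU XY).-sigma.-measurable C ->
    (forall k, C `<=` @internal_set U UU _ (D k)) ->
    (forall e, 0 < e -> exists k, udens R U (D k) < e) -> mu C = 0%E.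
  move=> mC CD De; apply/eqP; rewrite eq_le measure_ge0 andbT.
  apply/lee_addgt0Pr => e e0; rewrite add0e; have [k ke] := De e e0.
  apply: (@le_trans _ _ (mu (@internal_set U UU _ (D k)))).
    by apply: le_measure; rewrite ?inE//; exact: measurable_internal.
  by rewrite muE lee_fin ltW.
move=> t1 t2 rect0.
case: t1 rect0 => [|t1].
  move=> /eqP[]; apply: (mu_null _ (fun k n => finset.setX (~: \bigcup_(i <
    k) A i n)%SET [set: Y n]%SET)).
  - by apply: measurable_ultra_rect; exact: measurable_internal_parts.
  - move=> k; rewrite -ultra_rect_internal => z [zl zr]; split.
      exact: internal_parts_rest zl.
    by rewrite internal_setT.
  - move=> e /restA[k ke]; exists k; rewrite udens_setX udensT mulr1; exact: ke.
case: t2 => [|t2].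
  move=> /eqP[]; apply: (mu_null _ (fun k n =>
    finset.setX [set: X n]%SET (~: \bigcup_(i < k) B i n)%SET)).
  - by apply: measurable_ultra_rect; exact: measurable_internal_parts.
  - move=> k; rewrite -ultra_rect_internal => z [zl zr]; split.
      by rewrite internal_setT.
    exact: internal_parts_rest zr.
  - move=> e /restB[k ke]; exists k; rewrite udens_setX udensT mul1r; exact: ke.
rewrite /= ultra_rect_internal muE -internal_setI muE /= udens_setX.
rewrite eqe => AB0.
have [At|At] := zA t1; last by move: AB0; rewrite At udens0 mul0r eqxx.
have [Bt|Bt] := zB t2; last by move: AB0; rewrite Bt udens0 mulr0 eqxx.
have [|e|e] := @udens_zero_one R U UU XY (fun n =>
  finset.setX (A t1 n) (B t2 n)) (fun n => edges (G n)).
- move=> e e0; have := pure_homogeneous (pA t1) (pB t2) At Bt e0.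
  have /udens_nonempty : 0 < @udens R U XY (fun n =>
    finset.setX (A t1 n) (B t2 n)).
    by rewrite udens_setX mulr_gt0.
  move=> AB1 /(_ UU) hom1; apply: filterS2 AB1 hom1 => n AB /(_ AB).
  rewrite /pair_density near01_div; last 2 first.
  + by rewrite ler0n ler_nat subset_leq_card// finset.subsetIr.
  + by rewrite ltr0n card_gt0.
  rewrite finset.setIC => /orP[|] /ltW h; [by left|right; move: h].
  by rewrite -[X in X%:R - _](cardsID (edges (G n))) natrD addrAC subrr add0r.
- left; rewrite (_ : udens R U _ = 0) ?mul0r// -[RHS]e.
  by apply: eq_udens; apply: nearW => n; rewrite finset.setIC.
right; set I := udens R U _; set S := (X in _ / X).
have S0 : 0 < S by rewrite mulr_gt0.
rewrite (_ : I = S) ?divff ?gt_eqF//.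
rewrite /S -udens_setX (@udensID R U UU XY _ (fun n =>
  edges (G n))) [X in _ + X]e addr0.
by apply: eq_udens; apply: nearW => n; rewrite finset.setIC.
Qed.

End StablePerfect.

(** * Ultraproducts of half graphs *)

Section Independence.
Context d d' (W : measurableType d) (T : measurableType d') (R : realType).
Variables (mu : probability W R) (p : W -> T) (D : set W).
Hypotheses (mp : measurable_fun setT p) (mD : measurable D).

(** Dynkin's theorem: for a fixed event [D], the sets [A] obeying the rule are closed under
    complement and countable disjoint union, so a generating family closed under intersection
    suffices. *)
Lemma independent_preimage (G : set (set T)) :
  @measurable _ T = <<s G >> -> setI_closed G ->
  (forall A, G A -> mu (p @^-1` A `&` D) = mu (p @^-1` A) * mu D)%E ->
  forall A, measurable A -> mu (p @^-1` A `&` D) = (mu (p @^-1` A) * mu D)%E.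
Proof.
move=> GE GI GD A; rewrite GE; move: A.
have mpA A : measurable A -> measurable (p @^-1` A).
  by move=> mA; rewrite -[X in measurable X]setTI; exact: mp.
apply: (@dynkin_induction _ _ G
  (fun A => mu (p @^-1` A `&` D) = (mu (p @^-1` A) * mu D)%E) GE GI) => //.
- by rewrite preimage_setT setTI probability_setT mul1e.
- move=> S mS; have -> : p @^-1` (~` S) = ~` (p @^-1` S) by [].
  have := mpA S mS; move: (p @^-1` S) => PS mPS IH; rewrite probability_setC//.
  rewrite setIC -setDE measureD//=; last by rewrite ltey_eq fin_num_measure.
  rewrite [D `&` _]setIC IH muleBl ?mul1e ?fin_num_measure//.
- move=> F mF tF IH; rewrite preimage_bigcup setI_bigcupl.
  have tpF : trivIset setT (fun k => p @^-1` F k).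
    move=> i j _ _ [x [? ?]]; apply: tF => //; by exists (p x).
  rewrite !measure_bigcup//; last 3 first.
  + by move=> k _; exact: mpA.
  + by move=> k _; apply: measurableI => //; exact: mpA.
  + by move=> i j _ _ [x [[? _] [? _]]]; apply: tpF => //; exists x.
  rewrite muleC -[X in (X * _)%E](@fineK _ (mu D)) ?fin_num_measure//.
  rewrite -nneseriesZl//; apply: eq_eseriesr => k _.
  by rewrite fineK ?fin_num_measure// [RHS]muleC; exact: IH.
Qed.

End Independence.

Section ProductRule.
Variables (R : realType) (U : set_system nat) (UU : UltraFilter U).
Variables (X Y : nat -> nefinType).
Local Notation XY := (fun n => nef_prod (X n) (Y n)).
Variable mu : probability (g_sigma_algebraType (@internal_sets U UU XY)) R.
Hypothesis muP : is_ultraproduct_measure mu.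
Local Notation p1 := (ultra_map (fun n => @nef_fst (X n) (Y n)) :
  ultraproduct UU XY -> ultraproduct UU X).
Local Notation p2 := (ultra_map (fun n => @nef_snd (X n) (Y n)) :
  ultraproduct UU XY -> ultraproduct UU Y).

Lemma internal_sets_setI (T : nat -> nefinType) :
  setI_closed (@internal_sets U UU T).
Proof.
by move=> _ _ [A _ <-] [B _ <-]; exists (fun n => A n :&: B n)%SET;
  rewrite ?internal_setI.
Qed.

Lemma mu_fst_internal A : mu (p1 @^-1` @internal_set U UU X A) =
  (udens R U A)%:E.
Proof.
have -> : p1 @^-1` @internal_set U UU X A = ultra_rect (internal_set A) setT.
  by rewrite /ultra_rect; apply/seteqP; split=> z //= [].
rewrite -internal_setT ultra_rect_internal (ultraproduct_measureE muP).
by rewrite udens_setX udensT mulr1.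
Qed.

Lemma mu_snd_internal B : mu (p2 @^-1` @internal_set U UU Y B) =
  (udens R U B)%:E.
Proof.
have -> : p2 @^-1` @internal_set U UU Y B = ultra_rect setT (internal_set B).
  by rewrite /ultra_rect; apply/seteqP; split=> z //= [].
rewrite -internal_setT ultra_rect_internal (ultraproduct_measureE muP).
by rewrite udens_setX udensT mul1r.
Qed.

Lemma measurable_fst_preimage A :
  (@internal_sets U UU X).-sigma.-measurable A ->
  (@internal_sets U UU XY).-sigma.-measurable (p1 @^-1` A).
Proof.
by move=> mA; rewrite -[X in measurable X]setTI; exact: measurable_ultra_fst.
Qed.

Lemma measurable_snd_preimage B :
  (@internal_sets U UU Y).-sigma.-measurable B ->
  (@internal_sets U UU XY).-sigma.-measurable (p2 @^-1` B).
Proof.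
by move=> mB; rewrite -[X in measurable X]setTI; exact: measurable_ultra_snd.
Qed.

(** The rule is known for internal sides by counting and is extended one side at a time: to
    measurable [A] against a fixed internal set, then to measurable [B] against the fixed [A]. *)
Lemma mu_ultra_rect A B :
  (@internal_sets U UU X).-sigma.-measurable A ->
  (@internal_sets U UU Y).-sigma.-measurable B ->
  mu (ultra_rect A B) = (mu (p1 @^-1` A) * mu (p2 @^-1` B))%E.
Proof.
move=> mA mB; rewrite muleC.
have -> : ultra_rect A B = p2 @^-1` B `&` p1 @^-1` A by rewrite setIC.
apply: (@independent_preimage _ _ _ (g_sigma_algebraType (@internal_sets U UU
  Y)) R
  mu p2 (p1 @^-1` A) _ _ (@internal_sets U UU Y)) => //.
- exact: measurable_ultra_snd.
- exact: measurable_fst_preimage.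
- exact: internal_sets_setI.
move=> _ [B0 _ <-]; rewrite setIC muleC.
apply: (@independent_preimage _ _ _ (g_sigma_algebraType (@internal_sets U UU
  X)) R
  mu p1 (p2 @^-1` internal_set B0) _ _ (@internal_sets U UU X)) => //.
- exact: measurable_ultra_fst.
- by apply: measurable_snd_preimage; exact: measurable_internal.
- exact: internal_sets_setI.
move=> _ [A0 _ <-]; rewrite mu_fst_internal mu_snd_internal -EFinM -udens_setX.
by rewrite -(ultraproduct_measureE muP) -ultra_rect_internal.
Qed.

End ProductRule.

Lemma measure_cover_neq0 d (T : measurableType d) (R : realType)
    (mu : probability T R) (C : set T) (F : nat -> set T) :
  measurable C -> (forall k, measurable (F k)) -> C `<=` \bigcup_k F k ->
  mu C != 0%E -> exists k, mu (C `&` F k) != 0%E.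
Proof.
move=> mC mF CF C0; apply: contrapT => /forallNP nk; case/eqP: C0.
have nk0 k : mu (C `&` F k) = 0%E by apply/eqP/negPn/negP/nk.
apply/eqP; rewrite eq_le measure_ge0 andbT.
have mCF k : measurable (C `&` F k) by exact: measurableI.
apply: (@le_trans _ _ (\sum_(k <oo) mu (C `&` F k))%E).
  apply: measure_sigma_subadditive => // x Cx.
  by have [k _ Fx] := CF x Cx; exists k.
by rewrite eseries0.
Qed.

(** * A grid of [M] equal steps along an enumerated ultraproduct *)

Section InitialSegments.
Variables (R : realType) (U : set_system nat) (UU : UltraFilter U).
Hypothesis ooU : \oo `<=` U.
Variables (T : nat -> nefinType) (e : forall n, 'I_n.+1 -> T n).
Hypothesis e_bij : forall n, bijective (@e n).
Variable M : nat.
Hypothesis M0 : (0 < M)%N.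

Definition initial_segment k n :=
  [set e i | i : 'I_n.+1 & (i < k * n.+1 %/ M)%N]%SET.

Lemma card_initial_segment k n : (k <= M)%N ->
  #|initial_segment k n| = (k * n.+1 %/ M)%N.
Proof.
move=> kM; rewrite card_imset; last exact: bij_inj.
have cn : (k * n.+1 %/ M <= n.+1)%N.
  by rewrite -[leqRHS](mulKn _ M0) leq_div2r// leq_mul2r kM orbT.
rewrite -sum1_card (eq_bigl (fun i : 'I_n.+1 => (i < k * n.+1 %/ M)%N));
  last first.
  by move=> i; rewrite inE.
by rewrite (big_ord_narrow cn) sum1_card card_ord.
Qed.

(** Rounding costs at most [n.+1%:R^-1], which vanishes along [U] because [U] contains the cofinite
    sets. *)
Lemma udens_initial_segment k : (k <= M)%N ->
  udens R U (initial_segment k) = k%:R / M%:R.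
Proof.
move=> kM; apply: udens_lim; apply/cvgrPdist_le => eps eps0.
have cardT n : #|T n| = n.+1 by rewrite -(bij_eq_card (e_bij n)) card_ord.
have MR : 0 < M%:R :> R by rewrite ltr0n.
have : \forall n \near U, n.+1%:R^-1 < eps.
  by apply: ooU; exact: (near_infty_natSinv_lt (PosNum eps0)).
apply: filterS => n neps; apply: le_trans (ltW neps).
rewrite /dens card_initial_segment// cardT; set c := (_ %/ _)%N.
have nR : 0 < n.+1%:R :> R by rewrite ltr0n.
have c1 : (c * M)%N%:R <= (k * n.+1)%N%:R :> R by rewrite ler_nat leq_trunc_div.
have c2 : (k * n.+1)%N%:R <= (c.+1 * M)%N%:R :> R.
  by rewrite ler_nat ltnW// ltn_ceil.
rewrite !natrM in c1 c2.
have -> : k%:R / M%:R - c%:R / n.+1%:R =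
    (k%:R * n.+1%:R - c%:R * M%:R) / M%:R / n.+1%:R :> R.
  by field; rewrite !gt_eqF.
rewrite ger0_norm; last by rewrite !divr_ge0 ?subr_ge0// ltW.
rewrite ler_pdivrMr// mulVf ?gt_eqF// ler_pdivrMr// mul1r.
by move: c2; rewrite -natr1; lra.
Qed.

Lemma initial_segment0 n : initial_segment 0 n = finset.set0.
Proof.
by apply/finset.setP => x; rewrite inE; apply/negbTE/imsetP => -[i];
  rewrite inE mul0n div0n.
Qed.

Lemma initial_segment_full n : initial_segment M n = [set: T n]%SET.
Proof.
apply/finset.setP => x; rewrite inE; apply/imsetP.
have [e' eK e'K] := e_bij n.
by exists (e' x); rewrite ?inE ?mulKn// ltn_ord.
Qed.

Lemma sub_initial_segment j k n : (j <= k)%N ->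
  initial_segment j n \subset initial_segment k n.
Proof.
move=> jk; apply: imsetS; apply/fintype.subsetP => i; rewrite !inE =>
  /leq_trans; apply.
by rewrite leq_div2r// leq_mul2r jk orbT.
Qed.

Lemma mem_initial_segment k n i :
  (e i \in initial_segment k n) = (i < k * n.+1 %/ M)%N.
Proof. by rewrite mem_imset ?inE//; exact: bij_inj. Qed.

End InitialSegments.

Section HalfGraphUltraproduct.
Variables (R : realType) (U : set_system nat) (UU : UltraFilter U).
Hypothesis ooU : \oo `<=` U.
Variables (G : nat -> bigraph) (a : forall n, 'I_n.+1 -> lpart (G n))
  (b : forall n, 'I_n.+1 -> rpart (G n)).
Hypothesis abG : forall n, half_graph_order (@a n) (@b n).

Local Notation X := (fun n => lpart (G n)).
Local Notation Y := (fun n => rpart (G n)).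
Local Notation XY := (fun n => nef_prod (lpart (G n)) (rpart (G n))).
Local Notation E := (@internal_set U UU XY (fun n => edges (G n))).

Let LX M k := @internal_set U UU X (initial_segment a M k).
Let LY M k := @internal_set U UU Y (initial_segment b M k).

Lemma low_high_edges M k : ultra_rect (LX M k) (~` LY M k) `<=` E.
Proof.
rewrite /LX /LY -internal_setC ultra_rect_internal.
apply/sub_internal_set; apply: nearW => n; have [[a' _ aK] [b' _ bK] ab] :=
  abG n.
apply/fintype.subsetP => -[x y]; rewrite !inE /= -(aK x) -(bK y) ab.
rewrite !mem_initial_segment; last 2 first.
- by move=> n'; have [] := abG n'.
- by move=> n'; have [] := abG n'.
by move=> /andP[ik]; rewrite -leqNgt => /(leq_trans ik)/ltnW.
Qed.

Lemma high_low_edges M k : ultra_rect (~` LX M k) (LY M k) `<=` ~` E.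
Proof.
rewrite /LX /LY -!internal_setC ultra_rect_internal.
apply/sub_internal_set; apply: nearW => n; have [[a' _ aK] [b' _ bK] ab] :=
  abG n.
apply/fintype.subsetP => -[x y]; rewrite !inE /= -(aK x) -(bK y) ab.
rewrite !mem_initial_segment; last 2 first.
- by move=> n'; have [] := abG n'.
- by move=> n'; have [] := abG n'.
by rewrite -!ltnNge => /andP[ik jk]; exact: leq_trans jk ik.
Qed.

(** Let [A] be a left part of positive measure. An interval [J] of right vertices is found such that
    [A] has positive measure both before and after it. A right part meeting [J] in positive measure
    then sees edges from the first portion of [A] and non-edges from the second, each with positive
    measure by the product rule, so its density with [A] is neither 0 nor 1. *)
Lemma half_graph_not_perfect : ~ perfect_stable_regularity UU R G.
Proof.
move=> [mu [muP [A1 [A2 [[P1 P2] mA1 mA2 hom]]]]].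
pose p1 : ultraproduct UU XY -> ultraproduct UU X := ultra_map (fun n =>
  @nef_fst (X n) (Y n)).
pose p2 : ultraproduct UU XY -> ultraproduct UU Y := ultra_map (fun n =>
  @nef_snd (X n) (Y n)).
have a_bij n : bijective (@a n) by have [] := abG n.
have b_bij n : bijective (@b n) by have [] := abG n.
have rectE := mu_ultra_rect muP.
have m1 A : (@internal_sets U UU X).-sigma.-measurable A ->
  (@internal_sets U UU XY).-sigma.-measurable (p1 @^-1` A) by exact:
    measurable_fst_preimage.
have m2 A : (@internal_sets U UU Y).-sigma.-measurable A ->
  (@internal_sets U UU XY).-sigma.-measurable (p2 @^-1` A) by exact:
    measurable_snd_preimage.
have mLX M k : (@internal_sets U UU X).-sigma.-measurable (LX M k) by exact:
  measurable_internal.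
have mLY M k : (@internal_sets U UU Y).-sigma.-measurable (LY M k) by exact:
  measurable_internal.
have [t tpos] : exists t, mu (p1 @^-1` A1 t) != 0%E.
  have [||||t] := @measure_cover_neq0 _ _ R mu setT (fun t => p1 @^-1` A1 t).
  - by [].
  - by move=> k; exact: m1.
  - move=> z _; have [k _ zk] : (\bigcup_k A1 k) (p1 z) by rewrite P1.2.
    by exists k.
  - by rewrite probability_setT onee_neq0.
  - by rewrite setTI => ?; exists t.
pose r S := fine (mu S).
have rE S : (@internal_sets U UU XY).-sigma.-measurable S -> mu S = (r S)%:E.
  by move=> mS; rewrite fineK// fin_num_measure.
have r_ge0 S : 0 <= r S by rewrite fine_ge0.
have r_gt0 S : (@internal_sets U UU XY).-sigma.-measurable S ->
  mu S != 0%E -> 0 < r S.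
  by move=> mS; rewrite rE// eqe lt_neqAle eq_sym r_ge0 andbT.
have rID S L : (@internal_sets U UU XY).-sigma.-measurable S ->
    (@internal_sets U UU XY).-sigma.-measurable L -> r S =
      r (S `&` L) + r (S `\` L).
  move=> mS mL; apply: EFin_inj; rewrite EFinD -!rE//.
  - by rewrite addeC; exact: measureDI.
  - exact: measurableD.
  - exact: measurableI.
have r_le S L : (@internal_sets U UU XY).-sigma.-measurable S ->
    (@internal_sets U UU XY).-sigma.-measurable L -> S `<=` L -> r S <= r L.
  by move=> mS mL SL; rewrite -lee_fin -!rE//; apply: le_measure; rewrite ?inE.
set A := A1 t in tpos; have mA :
  (@internal_sets U UU X).-sigma.-measurable A by exact: mA1.
have alpha0 := r_gt0 _ (m1 _ mA) tpos; set alpha := r _ in alpha0.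
(* Two grid steps must not exhaust [A]: one contains the first mass of [A], the next is the place of
   [J]. *)
have [M M0 Malpha] : exists2 M, (0 < M)%N & 2 / M%:R < alpha.
  have a2 : 0 < alpha / 2 by rewrite divr_gt0.
  have [k _ /(_ k (leqnn k)) /= ke] := near_infty_natSinv_lt (PosNum a2).
  have {}ke : k.+1%:R^-1 < alpha / 2 := ke.
  by exists k.+1; rewrite // -ltr_pdivlMl// mulrC.
have MR : 0 < M%:R :> R by rewrite ltr0n.
pose L k := p1 @^-1` LX M k; pose PA := p1 @^-1` A.
have mL k : (@internal_sets U UU XY).-sigma.-measurable (L k) by exact: m1.
have mPA : (@internal_sets U UU XY).-sigma.-measurable PA by exact: m1.
have rL k : (k <= M)%N -> r (L k) = k%:R / M%:R.
  by move=> kM; rewrite /r mu_fst_internal//= udens_initial_segment.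
have L0 : L 0 = set0.
  rewrite /L /LX (_ : internal_set _ = set0) ?preimage_set0// -internal_set0.
  by apply: eq_internal_set; apply: nearW => n; rewrite initial_segment0.
have LM : L M = setT.
  rewrite /L /LX (_ : internal_set _ = setT) ?preimage_setT// -internal_setT.
  by apply: eq_internal_set; apply: nearW => n; rewrite initial_segment_full.
have L_incr j k : (j <= k)%N -> L j `<=` L k.
  move=> jk; apply: preimage_subset; apply/sub_internal_set.
  by apply: nearW => n; exact: sub_initial_segment.
have step j k : (j <= k <= M)%N ->
    r (PA `&` L k) <= r (PA `&` L j) + (k%:R - j%:R) / M%:R.
  move=> /andP[jk kM].
  have mPL i : (@internal_sets U UU XY).-sigma.-measurable (PA `&` L i).
    exact: measurableI.
  rewrite (rID _ _ (mPL k) (mL j)); apply: lerD.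
    by apply: r_le; [exact: measurableI|exact: mPL|move=> z [[]]].
  apply: (@le_trans _ _ (r (L k `\` L j))).
    by apply: r_le; [exact: measurableD|exact: measurableD|move=> z [[]]].
  have := rID (L k) (L j) (mL k) (mL j).
  by rewrite (setIidr (L_incr _ _ jk)) !rL ?(leq_trans jk)// mulrBl; lra.
have exk : exists k, 0 < r (PA `&` L k) by exists M; rewrite LM setIT.
(* [k.+1] is the first grid point with positive mass of [A] before it. Hence at most [2 / M] of [A]
   lies before [k.+2], and some of [A] lies beyond. *)
case: (ex_minnP exk) => -[|k] rk mink.
  by move: rk; rewrite L0 setI0 /r measure0 ltxx.
have rk0 : r (PA `&` L k) = 0.
  apply/eqP; rewrite eq_le r_ge0 andbT leNgt; apply/negP => /mink.
  by rewrite ltnn.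
have kM : (k.+2 <= M)%N.
  have kM : (k.+1 <= M)%N by apply: mink; rewrite LM setIT.
  rewrite ltn_neqAle kM andbT; apply/eqP => kM'.
  have := step k k.+1; rewrite leqnSn kM => /(_ isT).
  rewrite rk0 add0r {1}kM' LM setIT -/alpha -natr1.
  have : 0 < M%:R^-1 :> R by rewrite invr_gt0.
  lra.
have high : 0 < r (PA `\` L k.+2).
  have := rID PA (L k.+2) mPA (mL _); rewrite -/alpha.
  have := step k k.+2; rewrite kM (leq_trans (leqnSn k) (leqnSn _)) => /(_ isT).
  rewrite rk0 add0r -!natr1; lra.
pose J := LY M k.+2 `\` LY M k.+1.
have mJ : (@internal_sets U UU Y).-sigma.-measurable J by exact: measurableD.
have J0 : mu (p2 @^-1` J) != 0%E.
  have rY j : (j <= M)%N -> r (p2 @^-1` LY M j) = j%:R / M%:R.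
    by move=> jM; rewrite /r mu_snd_internal//= udens_initial_segment.
  rewrite rE ?eqe; last exact: m2.
  have := rID (p2 @^-1` LY M k.+2) (p2 @^-1` LY M k.+1) (m2 _ (mLY _ _)) (m2 _
    (mLY _ _)).
  rewrite -preimage_setI (setIidr (_ : LY M k.+1 `<=` LY M k.+2)); last first.
    by apply/sub_internal_set; apply: nearW => n; exact: sub_initial_segment.
  rewrite !rY ?(leq_trans (leqnSn _) kM)// => e.
  have {}e : k.+2%:R / M%:R = k.+1%:R / M%:R + r (p2 @^-1` J) := e.
  rewrite gt_eqF//; move: e; rewrite -[k.+2%:R]natr1 mulrDl mul1r.
  have : 0 < M%:R^-1 :> R by rewrite invr_gt0.
  lra.
have [s spos] : exists s, mu (p2 @^-1` (J `&` A2 s)) != 0%E.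
  have [||||s] := @measure_cover_neq0 _ _ R mu (p2 @^-1` J) (fun s =>
    p2 @^-1` A2 s).
  - exact: m2.
  - by move=> j; exact: m2.
  - move=> z _; have [j _ zj] : (\bigcup_j A2 j) (p2 z) by rewrite P2.2.
    by exists j.
  - exact: J0.
  - by move=> ?; exists s.
pose Q := J `&` A2 s.
have mQ : (@internal_sets U UU Y).-sigma.-measurable Q by exact: measurableI.
have rect_pos S : (@internal_sets U UU X).-sigma.-measurable S ->
    0 < r (p1 @^-1` S) -> 0 < r (ultra_rect S Q).
  move=> mS S0; rewrite /r rectE//= rE; last exact: m1.
  by rewrite fineM ?fin_num_measure//= ?mulr_gt0//;
    [exact: r_gt0 (m2 _ mQ) spos|exact: m2].
have mE : (@internal_sets U UU XY).-sigma.-measurable E by exact: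
  measurable_internal.
pose D := ultra_rect A (A2 s).
have mD : (@internal_sets U UU XY).-sigma.-measurable D by exact:
  measurable_ultra_rect.
have ED0 : 0 < r (E `&` D).
  apply: (lt_le_trans (rect_pos (A `&` LX M k.+1) _ _)).
  - exact: measurableI.
  - exact: rk.
  apply: r_le; [|exact: measurableI|].
    by apply: measurable_ultra_rect => //; exact: measurableI.
  move=> z [[zA zL] [[_ zJ] zs]]; split=> //.
  by apply: (@low_high_edges M k.+1).
have DE0 : 0 < r (D `\` E).
  apply: (lt_le_trans (rect_pos (A `\` LX M k.+2) _ _)).
  - exact: measurableD.
  - exact: high.
  apply: r_le; [|exact: measurableD|].
    by apply: measurable_ultra_rect => //; exact: measurableD.
  move=> z [[zA zL] [[zJ _] zs]]; split=> //.
  by apply: (@high_low_edges M k.+2).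
have := rID D E mD mE; rewrite setIC => rD.
have D0 : mu (ultra_rect (A1 t) (A2 s)) != 0%E.
  by rewrite -/A -/D rE// eqe gt_eqF// rD addr_gt0.
have := hom t s D0; rewrite -/A -/D -/(r D) -/(r (E `&` D)) /=.
have rD0 : 0 < r D by rewrite rD addr_gt0.
case=> [/eqP|h].
  by rewrite mulf_eq0 invr_eq0 !gt_eqF.
have : r (E `&` D) = r D by rewrite -[RHS]mul1r -h divfK// gt_eqF.
lra.
Qed.

End HalfGraphUltraproduct.

(** * The equivalence *)

Lemma perfect_stable_regularity_bounded (R : realType) (F : bigraph -> Prop) :
  hereditarily_closed F ->
  (forall (G : nat -> bigraph) (U : set_system nat) (UU : UltraFilter U),
     (forall n, F (G n)) -> perfect_stable_regularity UU R G) ->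
  exists d, forall G, F G -> stable d G.
Proof.
move=> hF HF; apply: contrapT => /(unstable_half_graph hF)/choice[G half].
have [U [UU ooU]] := ultraFilterLemma eventually_filter.
pose a n := sval (cid (half n)); pose b n := sval (cid (svalP (cid (half n)))).
have ab n : F (G n) /\ half_graph_order (a n) (b n) :=
  svalP (cid (svalP (cid (half n)))).
apply: (half_graph_not_perfect (UU := UU) ooU (a := a) (b := b)) => [n|].
  by have [] := ab n.
by apply: HF => n; have [] := ab n.
Qed.

Theorem theorem2 (R : realType) (F : bigraph -> Prop)
    (hF : hereditarily_closed F) :
  [<-> (forall (G : nat -> bigraph) (U : set_system nat)
          (UU : UltraFilter U),
          (forall n, F (G n)) -> perfect_stable_regularity UU R G);
       approximately_perfect_stable_regularity R F;
       strong_stable_regularity R F;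
       stable_regularity R F;
       (exists d : nat, forall G : bigraph, F G -> stable d G)].
Proof.
have stable_perfect_approx : (exists d : nat, forall G : bigraph, F G ->
  stable d G) ->
    approximately_perfect_stable_regularity R F.
  move=> [d Fd] eps f eps0 f01.
  have [n|N HN] := stable_family_regular Fd eps0 (f := f);
    first by case/andP: (f01 n).
  exists N => G /HN[N' [/andP[N'1 N'N] [A1 [A2 [part [rest1 rest2] hom _]]]]].
  exists N'; split=> //; exists A1, A2; split=> //; split.
    by rewrite (le_trans rest1)// ler_pM2l// ler_nat max_card.
  by rewrite (le_trans rest2)// ler_pM2l// ler_nat max_card.
have stable_strong : (exists d : nat, forall G : bigraph, F G -> stable d G) ->
    strong_stable_regularity R F.
  move=> [d Fd] eps f eps0 f01.
  have [n|N HN] := stable_family_regular Fd eps0 (f := f);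
    first by case/andP: (f01 n).
  exists N => G /HN[N' [N'N [A1 [A2 [part rest _ hom]]]]].
  by exists N'; split=> //; exists A1, A2.
(* In the cycle, the steps from perfect to approximately perfect and from there to strong regularity
   both pass through bounded stability. *)
tfae.
- by move=> /(perfect_stable_regularity_bounded hF)/stable_perfect_approx.
- by move=> /(approximately_perfect_bounded hF)/stable_strong.
- exact: strong_stable_regularity_stable.
- exact: stable_regularity_bounded.
- by move=> [d Fd] G U UU FG; apply: stable_perfect_regular => n; exact: Fd.
Qed.
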